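(* Let $\mathsf{k}$ be a field of characteristic zero, let $T=(1,3,4^k,3,1)$ and $j=k+3$. Consider the following list of Jordan degree types. #1: $((j+1)_0,((j-1)_1)^2,(j-3)_2)$; #2: $((j+1)_0,((j-1)_1)^2,1\uparrow_2^{j-2})$; #3: $((j+1)_0,(j-1)_1,(j-2)\uparrow_1^2)$; #4: $((j+1)_0,(j-1)_1,(j-3)_2,1\uparrow_1^{j-1})$; #5: $((j+1)_0,(j-1)_1,2\uparrow_1^{j-2})$; #6: $((j+1)_0,(j-1)_1,2\uparrow_2^{j-3},1_{1,2,j-2,j-1})$; #7: $((j+1)_0,(j-1)_1,1_1,(1\uparrow_2^{j-2})^2,1_{j-1})$; #8: $((j+1)_0,(j-2)\uparrow_1^2,1\uparrow_1^{j-1})$; #9: $((j+1)_0,3\uparrow_1^{j-3},2_{1,j-2})$; #10: $((j+1)_0,3\uparrow_1^{j-3},1_{1,2,j-2,j-1})$; #11: $((j+1)_0,2\uparrow_1^{j-2},1\uparrow_1^{j-1})$; #12: $((j+1)_0,(1\uparrow_1^{j-1})^2,1\uparrow_2^{j-2})$; #13: $(j\uparrow_0^1,(j-1)_1,(j-3)_2)$; #14: $(j\uparrow_0^1,(j-1)_1,1\uparrow_2^{j-2})$; #15: $(j\uparrow_0^1,(j-2)_{1,2})$; #16: $(j\uparrow_0^1,(j-3)_2,1\uparrow_1^{j-1})$; #17: $(j\uparrow_0^1,2\uparrow_1^{j-2})$; #18: $(j\uparrow_0^1,2\uparrow_2^{j-3},1_{1,2,j-2,j-1})$; #19: $(j\uparrow_0^1,1_1,(1\uparrow_2^{j-2})^2,1_{j-1})$;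 #20: $((j-1)_0,((j-1)_1)^2,(j-1)_2)$; #21: $((j-1)\uparrow_0^2,1\uparrow_1^{j-1})$; #22: $(4\uparrow_0^{j-3},2_1,2_{j-2})$; #23: $(4\uparrow_0^{j-3},1_{1,2,j-2,j-1})$; #24: $(3\uparrow_0^{j-2},1\uparrow_1^{j-1})$; #25: $(2\uparrow_0^{j-1},2\uparrow_1^{j-2})$; #26: $(2\uparrow_0^{j-1},1_1,(1\uparrow_2^{j-2})^2,1_{j-1})$. ''Occurring'' means equal to $\mathcal{S}_{A,\ell}$ for some $A\in\mathrm{Gor}(T)$ and some nonzero linear form $\ell\in A_1$. (i) If $k\ge 3$, there are exactly $26$ occurring Jordan degree types, namely #1–#26. (ii) If $k=2$, there are exactly $22$ occurring Jordan degree types, namely those of the list, where now #4=#6, #8=#10, #16=#18 and #21=#23. (iii) If $k=1$, there are exactly $12$ occurring Jordan degree types, namely #1, #3 (which equals #5), #7, #8, #12, #13, #15, #19, #20, #24, #25, #26.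
   Context: $R=\mathsf{k}[x,y,z]$ with the standard grading; $4^k$ means that $4$ is repeated $k$ times. $\mathrm{Gor}(T)$ is the family of graded Artinian Gorenstein quotients $A=R/I$ with Hilbert function $T$; $j$ is the socle degree. Jordan degree type (JDT): for a graded Artinian algebra $A$ and $\ell\in A_1$, $A$ is a direct sum of graded cyclic $\mathsf{k}[\ell]$-modules (strings) $\langle v_i,\ell v_i,\dots,\ell^{p_i-1}v_i\rangle$ with $v_i$ homogeneous of degree $\nu_i$ and $\ell^{p_i}v_i=0$; the multiset $\mathcal{S}_{A,\ell}=\{(p_i,\nu_i)\}$ is uniquely determined by $(A,\ell)$ and is called the Jordan degree type. Notation: $p_\nu$ denotes the pair $(p,\nu)$ (a string of length $p$ starting in degree $\nu$); $p_{a,b,\dots}$ denotes $p_a,p_b,\dots$; $p\uparrow_a^b$ denotes the collection $p_a,p_{a+1},\dots,p_b$ (empty if $b<a$); an exponent denotes multiplicity. *)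

(* Defs.v *)
From HB Require Import structures.
From mathcomp Require Import all_boot all_order all_algebra.
From mathcomp Require Export ring_quotient mpoly finmap multiset.

Set Implicit Arguments.
Unset Strict Implicit.
Unset Printing Implicit Defensive.

Import GRing.Theory.
Local Open Scope ring_scope.
Local Open Scope quotient_scope.

Notation jdtype := ({mset (nat * nat)%type})%mset.

Section Dimension.
Variables (K : fieldType) (V : lmodType K).

(* [W] is meant to be (the carrier of) a linear subspace of [V], which need not
   be a [vectType]. *)
Definition is_basis (W : V -> Prop) (s : seq V) : Prop :=
  (forall i : 'I_(size s), W s`_i) /\
  (forall v, W v ->
     exists! c : {ffun 'I_(size s) -> K}, v = \sum_(i < size s) c i *: s`_i).

Definition has_dim (W : V -> Prop) (n : nat) : Prop :=
  exists2 s : seq V, size s = n & is_basis W s.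

End Dimension.

Section QuotientAlgebra.
Variables (K : fieldType) (n : nat) (I : idealr {mpoly K[n]}).
Local Notation A := {ideal_quot I}.

Definition quot_scale (c : K) (a : A) : A := \pi_A (c%:MP) * a.

Fact quot_scaleA c d a : quot_scale c (quot_scale d a) = quot_scale (c * d) a.
Proof. by rewrite /quot_scale mpolyCM rmorphM mulrA. Qed.

Fact quot_scale1 : left_id 1 quot_scale.
Proof. by move=> a; rewrite /quot_scale rmorph1 mul1r. Qed.

Fact quot_scaleDr : right_distributive quot_scale +%R.
Proof. by move=> c a b; rewrite /quot_scale mulrDr. Qed.

Fact quot_scaleDl a : {morph quot_scale^~ a : c d / c + d}.
Proof. by move=> c d; rewrite /quot_scale mpolyCD rmorphD mulrDl. Qed.

HB.instance Definition _ := GRing.Zmodule_isLmodule.Build K A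
  quot_scaleA quot_scale1 quot_scaleDr quot_scaleDl.

Fact quot_scaleAl (c : K) (a b : A) : c *: (a * b) = (c *: a) * b.
Proof. by rewrite /GRing.scale /= /quot_scale mulrA. Qed.

HB.instance Definition _ :=
  GRing.Lmodule_isLalgebra.Build K A quot_scaleAl.

Definition homogeneous_ideal : Prop :=
  forall p, p \in I -> forall d, pihomog mdeg d p \in I.

Definition graded_piece (d : nat) (a : A) : Prop :=
  exists2 p : {mpoly K[n]}, p \is d.-homog & a = \pi_A p.

Definition has_hilbert_function (T : seq nat) : Prop :=
  forall d, has_dim (graded_piece d) (nth 0%N T d).

Definition artinian : Prop := exists N, has_dim (fun _ : A => True) N.

Definition irrelevant_ideal (a : A) : Prop :=
  exists2 p : {mpoly K[n]}, p@_0%MM = 0 & a = \pi_A p.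

Definition socle (a : A) : Prop := forall b, irrelevant_ideal b -> b * a = 0.

Definition gorenstein : Prop := has_dim socle 1.

Definition string (l v : A) (p : nat) : seq A := [seq l ^+ i * v | i <- iota 0 p].

(* [S] is the multiset of the pairs (length, initial degree) of a decomposition
   of [A] as a direct sum of graded [K[l]]-strings; an entry [(v, (p, nu))] of
   [s] is a string of length [p] generated by [v] in degree [nu]. *)
Definition jordan_degree_type (l : A) (S : jdtype) : Prop :=
  exists s : seq (A * (nat * nat)),
    [/\ forall v p nu, (v, (p, nu)) \in s ->
          [/\ (0 < p)%N, graded_piece nu v & l ^+ p * v = 0],
        is_basis (fun _ : A => True) (flatten [seq string l x.1 x.2.1 | x <- s])
      & S = seq_mset [seq x.2 | x <- s]].

End QuotientAlgebra.

Definition Gor (K : fieldType) (T : seq nat) (I : idealr {mpoly K[3]}) : Prop :=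
  [/\ homogeneous_ideal I, artinian I, gorenstein I & has_hilbert_function I T].

Definition occurring (K : fieldType) (T : seq nat) (S : jdtype) : Prop :=
  exists2 I : idealr {mpoly K[3]}, Gor T I &
  exists l : {ideal_quot I},
    [/\ graded_piece 1 l, l != 0 & jordan_degree_type l S].

Definition occurring_exactly (K : fieldType) (T : seq nat) (N : nat)
    (L : seq jdtype) : Prop :=
  size (undup L) = N /\ forall S, occurring K T S <-> S \in L.

Local Open Scope nat_scope.

Definition T4 (k : nat) : seq nat := [:: 1; 3] ++ nseq k 4 ++ [:: 3; 1].

(* [at_ p [:: a; b; ..]] is p_{a,b,..}, [up p a b] is p_a, .., p_b. *)
Definition at_ (p : nat) (nus : seq nat) : seq (nat * nat) :=
  [seq (p, nu) | nu <- nus].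

Definition up (p a b : nat) : seq (nat * nat) := at_ p (index_iota a b.+1).

Definition pow (s : seq (nat * nat)) (m : nat) : seq (nat * nat) :=
  flatten (nseq m s).

Definition jdt_seq (j i : nat) : seq (nat * nat) :=
  match i with
  | 1 => at_ (j + 1) [:: 0] ++ pow (at_ (j - 1) [:: 1]) 2 ++ at_ (j - 3) [:: 2]
  | 2 => at_ (j + 1) [:: 0] ++ pow (at_ (j - 1) [:: 1]) 2 ++ up 1 2 (j - 2)
  | 3 => at_ (j + 1) [:: 0] ++ at_ (j - 1) [:: 1] ++ up (j - 2) 1 2
  | 4 => at_ (j + 1) [:: 0] ++ at_ (j - 1) [:: 1] ++ at_ (j - 3) [:: 2]
           ++ up 1 1 (j - 1)
  | 5 => at_ (j + 1) [:: 0] ++ at_ (j - 1) [:: 1] ++ up 2 1 (j - 2)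
  | 6 => at_ (j + 1) [:: 0] ++ at_ (j - 1) [:: 1] ++ up 2 2 (j - 3)
           ++ at_ 1 [:: 1; 2; j - 2; j - 1]
  | 7 => at_ (j + 1) [:: 0] ++ at_ (j - 1) [:: 1] ++ at_ 1 [:: 1]
           ++ pow (up 1 2 (j - 2)) 2 ++ at_ 1 [:: j - 1]
  | 8 => at_ (j + 1) [:: 0] ++ up (j - 2) 1 2 ++ up 1 1 (j - 1)
  | 9 => at_ (j + 1) [:: 0] ++ up 3 1 (j - 3) ++ at_ 2 [:: 1; j - 2]
  | 10 => at_ (j + 1) [:: 0] ++ up 3 1 (j - 3) ++ at_ 1 [:: 1; 2; j - 2; j - 1]
  | 11 => at_ (j + 1) [:: 0] ++ up 2 1 (j - 2) ++ up 1 1 (j - 1)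
  | 12 => at_ (j + 1) [:: 0] ++ pow (up 1 1 (j - 1)) 2 ++ up 1 2 (j - 2)
  | 13 => up j 0 1 ++ at_ (j - 1) [:: 1] ++ at_ (j - 3) [:: 2]
  | 14 => up j 0 1 ++ at_ (j - 1) [:: 1] ++ up 1 2 (j - 2)
  | 15 => up j 0 1 ++ at_ (j - 2) [:: 1; 2]
  | 16 => up j 0 1 ++ at_ (j - 3) [:: 2] ++ up 1 1 (j - 1)
  | 17 => up j 0 1 ++ up 2 1 (j - 2)
  | 18 => up j 0 1 ++ up 2 2 (j - 3) ++ at_ 1 [:: 1; 2; j - 2; j - 1]
  | 19 => up j 0 1 ++ at_ 1 [:: 1] ++ pow (up 1 2 (j - 2)) 2 ++ at_ 1 [:: j - 1]
  | 20 => at_ (j - 1) [:: 0] ++ pow (at_ (j - 1) [:: 1]) 2 ++ at_ (j - 1) [:: 2]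
  | 21 => up (j - 1) 0 2 ++ up 1 1 (j - 1)
  | 22 => up 4 0 (j - 3) ++ at_ 2 [:: 1] ++ at_ 2 [:: j - 2]
  | 23 => up 4 0 (j - 3) ++ at_ 1 [:: 1; 2; j - 2; j - 1]
  | 24 => up 3 0 (j - 2) ++ up 1 1 (j - 1)
  | 25 => up 2 0 (j - 1) ++ up 2 1 (j - 2)
  | 26 => up 2 0 (j - 1) ++ at_ 1 [:: 1] ++ pow (up 1 2 (j - 2)) 2
            ++ at_ 1 [:: j - 1]
  | _ => [::]
  end.

Definition jdt (j i : nat) : jdtype := seq_mset (jdt_seq j i).

(* Main.v *)
Require Import Defs.
From HB Require Import structures.
From mathcomp Require Import all_boot all_order all_algebra falgebra.
From mathcomp Require Import zify.
Import GRing.Theory.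

Local Open Scope nat_scope.

(** For a linear form [l], the numbers h(i,d) = dim l^i A_d and the Jordan
    degree type determine each other: h(i,d) counts the strings that start in
    degree at most d and are still alive in degree d + i, and counting the
    strings of a given length and degree inverts this ([perm_of_string_ranks]).
    The proof determines the possible tables h.

    Constraints. Column 0 is the Hilbert function, and the Gorenstein pairing
    A_d x A_(j-d) -> A_j makes column i, the function h(i, _) on 0 .. j - i,
    symmetric. If l, y, z span A_1, then l^i A_(d+1) is generated modulo l^(i+1)
    A_d by l^i times the d + 2 monomials in y and z; the argument of Macaulay in
    two variables (the leading monomials outside an ideal cannot become more
    numerous once one of them is missing) bounds the growth of h(i,d) -
    h(i+1,d-1). Counting strings adds a convexity inequality between three
    neighbouring columns. All this is recorded in [gor_ranks], proved in
    [gor_ranks_of_strings]. Together they leave six possible forms for a column,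
    namely (1,3,4,..,4,3,1), (1,3,..,3,1), (1,2,3,..,3,2,1), (1,2,..,2,1),
    (1,..,1) and 0 ([ranks_has_profile]). Columns shrink, and convexity makes a
    change between two columns force most of the later ones: when columns 1 and
    2 are equal, so are the later ones until they become short, and otherwise
    the columns descend at once to (1,2,..,2,1), (1,..,1) or 0, which persist
    once repeated. This leaves 26 tables when j > 5, and their specialisations
    when j is 4 or 5 ([classification]).

    Existence. Take l = x and the ideal apolar to a sum F of monomials x^(j-b-c)
    y^b z^c, that is, the largest ideal on which the functional p |-> <F, p>
    vanishes. For each table there are such an F and explicit generators of
    strings such that, in the Gram matrix of the pairing (p, q) |-> <F, pq>,
    each generator meets exactly one other generator at the right distance. The
    strings are then independent, and a count of dimensions shows that they
    span: few monomials suffice in the middle degrees, and the two top degrees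
    are dual to degrees 0 and 1 ([dual_system_occurring]). Gram entries are
    small nonzero integers, which is where characteristic zero enters.

    An occurring type and the type realised by its table have the same h, hence
    are equal ([occurringP]); it remains to see which types of the list
    coincide. *)

(** * Ranks of powers read off a Jordan degree type *)

(** Number of strings contributing to l^i A_d: those that start in degree at most
    [d] and reach degree [d + i].  This is dim l^i A_d when [s] is the type of
    (A, l). *)
Definition string_rank (s : seq (nat * nat)) (i d : nat) : nat :=
  count (fun x => (x.2 <= d) && (d + i < x.2 + x.1)) s.

Lemma string_rank_cat s t i d : string_rank (s ++ t) i d = string_rank s i d + string_rank t i d.
Proof. exact: count_cat. Qed.

Lemma string_rank_pow2 s i d : string_rank (pow s 2) i d = (string_rank s i d).*2.
Proof. by rewrite /pow /= cats0 string_rank_cat addnn. Qed.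

Lemma string_rank_up p a b i d :
  string_rank (up p a b) i d = (minn b d).+1 - maxn a ((d + i).+1 - p).
Proof.
rewrite /up /at_ /string_rank count_map /index_iota.
have [m Em] : exists m, m = b.+1 - a by exists (b.+1 - a).
rewrite -Em; elim: m a Em => [|m IH] a Em; first by rewrite /=; lia.
by rewrite /= IH; lia.
Qed.

Lemma string_rank_mono s i d : string_rank s i.+1 d <= string_rank s i d.
Proof. by apply: sub_count => x /=; lia. Qed.

Lemma string_rank_conv s i d :
  string_rank s i.+1 d + string_rank s i.+1 d.+1 <=
  string_rank s i d.+1 + string_rank s i.+2 d.
Proof. by rewrite /string_rank; elim: s => //= x s IH; lia. Qed.

(** The six forms of a column h(i, _), named by their first three values; the
    third value is repeated up to the middle, and the rest follows by symmetry. *)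
Inductive profile := P134 | P133 | P123 | P122 | P111 | P000.

Definition profile_head (c : profile) (d : nat) : nat :=
  match c, d with
  | P000, _ => 0
  | _, 0 => 1
  | (P134 | P133), 1 => 3
  | (P123 | P122), 1 => 2
  | P111, _ => 1
  | P134, _ => 4
  | (P133 | P123), _ => 3
  | P122, _ => 2
  end.

(** Value in degree [d] of a symmetric column supported on 0 .. [s]: the distance
    to the nearer end, truncated at 2, selects the entry. *)
Definition profile_rank (c : profile) (s d : nat) : nat :=
  profile_head c (minn 2 (minn d (s - d))).

(** Column [i] of the table attached to the [n]-th type of the list.  The local
    [fin] expresses that the types 13 to 19 have no string of length j + 1, so
    that l^j = 0, unlike their companions 1 to 7. *)
Definition column_profile (j n i : nat) : profile :=
  let fin c := if i == j then P000 else c in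
  if i == 0 then P134 else
  match n with
  | 1 => if i + 4 <= j then P134 else if i + 2 <= j then P133 else P111
  | 2 => if i + 2 <= j then P133 else P111
  | 3 => if i + 4 <= j then P134 else if i + 3 <= j then P133
         else if i + 2 <= j then P122 else P111
  | 4 => if i + 4 <= j then P123 else if i + 2 <= j then P122 else P111
  | 5 => if i == 1 then P133 else if i + 2 <= j then P122 else P111
  | 6 => if i == 1 then P123 else if i + 2 <= j then P122 else P111
  | 7 => if i + 2 <= j then P122 else P111
  | 8 => if i + 4 <= j then P123 else if i + 3 <= j then P122 else P111
  | 9 => if i == 1 then P133 else if i == 2 then P122 else P111
  | 10 => if i == 1 then P123 else if i == 2 then P122 else P111
  | 11 => if i == 1 then P122 else P111
  | 12 => P111
  | 13 => if i + 4 <= j then P134 else if i + 2 <= j then P133 else fin P111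
  | 14 => if i + 2 <= j then P133 else fin P111
  | 15 => if i + 4 <= j then P134 else if i + 3 <= j then P133
         else if i + 2 <= j then P122 else fin P111
  | 16 => if i + 4 <= j then P123 else if i + 2 <= j then P122 else fin P111
  | 17 => if i == 1 then P133 else if i + 2 <= j then P122 else fin P111
  | 18 => if i == 1 then P123 else if i + 2 <= j then P122 else fin P111
  | 19 => if i + 2 <= j then P122 else fin P111
  | 20 => if i + 4 <= j then P134 else if i + 3 <= j then P133
         else if i + 2 <= j then P122 else P000
  | 21 => if i + 4 <= j then P123 else if i + 3 <= j then P122
          else if i + 2 <= j then P111 else P000
  | 22 => if i == 1 then P133 else if i == 2 then P122 else if i == 3 then P111 else P000
  | 23 => if i == 1 then P123 else if i == 2 then P122 else if i == 3 then P111 else P000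
  | 24 => if i == 1 then P122 else if i == 2 then P111 else P000
  | 25 => if i == 1 then P122 else P000
  | 26 => if i == 1 then P111 else P000
  | _ => P000
  end.

Lemma string_rank_at_nil p i d : string_rank (at_ p [::]) i d = 0. Proof. by []. Qed.

Lemma string_rank_at_cons p nu s i d :
  string_rank (at_ p (nu :: s)) i d = ((nu <= d) && (d + i < nu + p)) + string_rank (at_ p s) i d.
Proof. by []. Qed.

Definition string_rankE :=
  (string_rank_cat, string_rank_pow2, string_rank_up, string_rank_at_cons,
   string_rank_at_nil).

Ltac splitif := repeat match goal with
  | |- context [if ?b then _ else _] =>
     let H := fresh in case: (boolP b) => H /=; try (exfalso; lia)
  end.

(** For j = 4 every type of the list equals one of these twelve. *)
Definition short_types := [:: 1; 3; 7; 8; 12; 13; 15; 19; 20; 24; 25; 26].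

(** A column of length j - i is known from its entries in degrees at most 2 that
    lie in its lower half, hence the bound [i + d.*2 <= j]. *)
Lemma string_rank_jdt j n i d : 4 < j -> 0 < n < 27 -> d <= 2 -> i + d.*2 <= j ->
  string_rank (jdt_seq j n) i d = profile_head (column_profile j n i) d.
Proof.
move=> j_gt n_in d2 le_ij; move: n_in.
do 27?[case: n => [|n]]; try (by move=> ?; lia); move=> _.
all: move: d d2 le_ij => [|[|[|//]]] _ le_ij.
all: cbv beta iota delta [jdt_seq]; rewrite ?string_rankE /column_profile /=.
all: splitif; lia.
Qed.

Lemma string_rank_jdt4 n i d : n \in short_types -> d <= 2 -> i + d.*2 <= 4 ->
  string_rank (jdt_seq 4 n) i d = profile_head (column_profile 4 n i) d.
Proof.
move=> n_in d2 le_ij; move: n_in; rewrite !inE.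
do !case/orP; move/eqP=> ->.
all: move: d i d2 le_ij => [|[|[|//]]] [|[|[|[|[|i]]]]] _ ? //.
Qed.

(** * Tables of ranks of a graded Gorenstein algebra *)

(** The inequalities between the numbers h(i,d) = dim l^i A_d on which the
    classification rests.  [gr_growth] is the two-variable case of
    Macaulay's bound for h(i,d+1) - h(i+1,d), the number of monomials in y and z
    needed to generate l^i A_(d+1) modulo l^(i+1) A_d: once fewer than all the
    d + 2 monomials are needed, the number cannot increase.  [gr_conv] says
    that the number of strings with a given start and a given length is at least
    zero. *)
Record gor_ranks (j : nat) (h : nat -> nat -> nat) : Prop := GorRanks {
  gr_hilb : forall d, h 0 d = nth 0 (T4 (j - 3)) d;
  gr_lin : h 1 0 = 1;
  gr_out : forall i d, j < i + d -> h i d = 0;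
  gr_sym : forall i d, i + d <= j -> h i d = h i (j - i - d);
  gr_zero : forall i d, h i d = 0 -> h i d.+1 = 0;
  gr_growth : forall i d, h i d.+1 <= h i.+1 d + d.+1 ->
    h i d.+2 + h i.+1 d <= h i d.+1 + h i.+1 d.+1;
  gr_mono : forall i d, h i.+1 d <= h i d;
  gr_conv : forall i d, h i.+1 d + h i.+1 d.+1 <= h i d.+1 + h i.+2 d }.

Lemma profile_rank0 c s : profile_rank c s 0 = profile_head c 0.
Proof. by rewrite /profile_rank min0n minn0. Qed.
Lemma profile_rank1 c s : 1 < s -> profile_rank c s 1 = profile_head c 1.
Proof. by move=> hs; rewrite /profile_rank; congr profile_head; lia. Qed.
Lemma profile_rank1r c s : 1 < s -> profile_rank c s s.-1 = profile_head c 1.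
Proof. by move=> hs; rewrite /profile_rank; congr profile_head; lia. Qed.
Lemma profile_rank2 c s d : 1 < d -> d + 2 <= s -> profile_rank c s d = profile_head c 2.
Proof. by move=> hs ?; rewrite /profile_rank; congr profile_head; lia. Qed.

Lemma profile_rankr c s : profile_rank c s s = profile_head c 0.
Proof. by rewrite /profile_rank subnn minn0. Qed.

Local Arguments profile_rank : simpl never.

Section Shape.
Variables (j : nat) (h : nat -> nat -> nat).
Hypotheses (j_gt3 : 3 < j) (hG : gor_ranks j h).

Lemma ranks0 d : d <= j -> h 0 d = profile_rank P134 j d.
Proof.
move=> le_dj; rewrite (gr_hilb _ _ hG) /T4.
case: d le_dj => [|[|d]] le_dj; rewrite ?profile_rank0 ?profile_rank1 //; try lia.
rewrite -[[:: 1; 3] ++ _]/(1 :: 3 :: _) /= nth_cat size_nseq nth_nseq.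
case: ltnP => [lt|ge]; first by rewrite profile_rank2 /=; lia.
have [ed|ed] : d = j - 3 \/ d = j - 3 + 1 by lia.
  by rewrite ed subnn (_ : (j - 3).+2 = j.-1) ?profile_rank1r /=; lia.
by rewrite ed addKn (_ : (j - 3 + 1).+2 = j) ?profile_rankr /=; lia.
Qed.

Lemma ranks_zero_column i d : h i 0 = 0 -> h i d = 0.
Proof. by move=> hi0; elim: d => // d IH; apply: gr_zero hG _ _ IH. Qed.

Lemma ranks_top i : i <= j -> h i (j - i) = h i 0.
Proof. by move=> le_ij; rewrite (gr_sym _ _ hG i 0) ?subn0 ?addn0. Qed.

(** A column with a zero entry is zero from there on, which by symmetry would
    kill its first entry. *)
Lemma ranks_gt0 i d : 0 < h i 0 -> i + d <= j -> 0 < h i d.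
Proof.
move=> hi0 le_ij; rewrite lt0n; apply/eqP => hd.
suff: forall m, h i (d + m) = 0.
  by move/(_ (j - i - d)); rewrite (_ : d + _ = j - i) ?ranks_top; lia.
by elim=> [|m IH]; rewrite ?addn0 // addnS; apply: gr_zero hG _ _ IH.
Qed.

(** The condition of [gr_growth] holds from degree 1 on, so that the differences
    h(i,d+1) - h(i+1,d) never exceed the first of them. *)
Lemma ranks_le1 i d : h i 1 <= 1 -> h i d.+1 <= 1.
Proof.
move=> hi1.
have step m : h i m.+2 + h i.+1 0 <= h i 1 + h i.+1 m.+1.
  elim: m => [|m IH]; first by have := gr_growth _ _ hG i 0; lia.
  by have := gr_growth _ _ hG i m.+1; have := gr_mono _ _ hG i.+1 0; lia.
elim: d => // d IH.
have [z|nz] := posnP (h i.+1 0); last first.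
  by have := step d; have := gr_mono _ _ hG i d.+1; lia.
by have := step d; rewrite (ranks_zero_column _ 0 z) (ranks_zero_column _ d.+1 z); lia.
Qed.

Definition has_profile (i : nat) : Prop :=
  exists c, forall d, i + d <= j -> h i d = profile_rank c (j - i) d.

Lemma profile_head_le3 c d : 0 < d -> profile_head c d <= 3 + (d != 1).
Proof. by case: c; case: d => [|[|d]]. Qed.

(** Column [i] constrains column [i.+1] through monotonicity and growth: since
    column [i] is constant in the middle, growth makes column [i.+1]
    nondecreasing in degrees 1 to s - 2, where s is its last degree; by symmetry
    it is constant in degrees 2 to s - 2, and only its entries in degrees 1 and 2
    remain to be enumerated. *)
Lemma has_profile_step i : i < j -> has_profile i -> has_profile i.+1.
Proof.
move=> lt_ij [c hc].
have hi0 : h i 0 = profile_head c 0 by rewrite hc ?profile_rank0; lia.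
have [z|nz] := posnP (h i.+1 0).
  exists P000 => d _; rewrite (ranks_zero_column _ _ z) /profile_rank; by case: (minn _ _).
have cZ : c <> P000 by move=> cZ; have := gr_mono _ _ hG i 0; rewrite hi0 cZ /=; lia.
have e1 : h i.+1 0 = 1.
  by have := gr_mono _ _ hG i 0; rewrite hi0; case: (c) => /=; lia.
have etop := ranks_top i.+1 lt_ij.
have [s_le1|s_gt1] := leqP (j - i.+1) 1.
  exists P111 => d le_d; rewrite /profile_rank /=.
  have [->|->] : d = 0 \/ d = j - i.+1 by lia.
    by rewrite e1; case: minn => [|[]].
  by rewrite etop e1; case: minn => [|[]].
have hi1 : h i 1 = profile_head c 1 by rewrite hc ?profile_rank1; lia.
have a_gt0 := ranks_gt0 i.+1 1 nz ltac:(lia).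
have a_le := gr_mono _ _ hG i 1.
have a_top : h i.+1 (j - i.+1).-1 = h i.+1 1.
  by rewrite (gr_sym _ _ hG) ?[_ - 1]subn1; [congr h|]; lia.
(* Below length 4 every degree is at distance at most 1 from an end. *)
have [s_lt4|s_ge4] := ltnP (j - i.+1) 4.
  have [c' [c'0 c'1]] : exists c', profile_head c' 0 = 1 /\ profile_head c' 1 = h i.+1 1.
    move: a_gt0 a_le; rewrite hi1; move: (h i.+1 1) => a a0 a3.
    have {}a3 : a <= 3 by apply: leq_trans a3 (profile_head_le3 c 1 _).
    case: a a0 a3 => [|[|[|[|]]]] // _ _; [by exists P111|by exists P122|by exists P133].
  exists c' => d le_d.
  have [->|[->|[->|->]]] : d = 0 \/ d = 1 \/ d = j - i.+1 \/ d = (j - i.+1).-1.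
    by lia.
  - by rewrite profile_rank0 e1.
  - by rewrite profile_rank1.
  - by rewrite etop e1 profile_rankr.
  - by rewrite a_top profile_rank1r.
have hi2 d : 1 < d -> d + i + 2 <= j -> h i d = profile_head c 2.
  by move=> d1 dj; rewrite hc ?profile_rank2; lia.
have [a_le1|a_gt1] := leqP (h i.+1 1) 1.
  exists P111 => d le_d.
  have -> : profile_rank P111 (j - i.+1) d = 1 by rewrite /profile_rank /=; case: minn => [|[]].
  case: d le_d => // d le_d.
  by have := ranks_le1 i.+1 d a_le1; have := ranks_gt0 _ _ nz le_d; lia.
have v4 : profile_head c 2 <= 4 by case: (c).
have up_chain d : 0 < d -> d + 3 <= j - i.+1 ->
    h i.+1 1 <= h i.+1 d <= h i.+1 d.+1.
  elim: d => // [] [|d] IH _ le_d.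
    rewrite leqnn /=.
    by have := gr_growth _ _ hG i 1; rewrite !hi2; lia.
  have := IH; have := gr_growth _ _ hG i d.+2; rewrite !hi2; lia.
have b_top : h i.+1 (j - i.+1 - 2) = h i.+1 2.
  by rewrite (gr_sym _ _ hG); [congr h|]; lia.
have b_low d : 1 < d -> d + 2 <= j - i.+1 -> h i.+1 2 <= h i.+1 d.
  elim: d => // d IH d1 le_d.
  have [->|d2] : d = 1 \/ 1 < d by lia.
    by [].
  by have := IH d2; have := up_chain d; lia.
have b_upp m : 1 < j - i.+1 - 2 - m -> h i.+1 (j - i.+1 - 2 - m) <= h i.+1 2.
  elim: m => [|m IH] hm; first by rewrite subn0 b_top.
  have := up_chain (j - i.+1 - 2 - m.+1).
  rewrite (_ : (j - i.+1 - 2 - m.+1).+1 = j - i.+1 - 2 - m); last by lia.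
  by have := IH; lia.
have mid d : 1 < d -> d + 2 <= j - i.+1 -> h i.+1 d = h i.+1 2.
  move=> d1 dj; have := b_low d d1 dj; have := b_upp (j - i.+1 - 2 - d).
  by rewrite (_ : _ - (_ - d) = d); lia.
have ab1 : h i.+1 1 <= h i.+1 2 by have := up_chain 1; have := b_low 2; lia.
(* Growth applied near the right end, read through the symmetry. *)
have ab2 : h i.+1 2 + h i 1 <= h i 2 + h i.+1 1.
  have := gr_growth _ _ hG i (j - i.+1 - 2).
  have -> : h i (j - i.+1 - 2).+1 = profile_head c 2 by apply: hi2; lia.
  have -> : h i (j - i.+1 - 2).+2 = h i 1.
    by rewrite (gr_sym _ _ hG); [congr h|]; lia.
  have -> : h i.+1 (j - i.+1 - 2).+1 = h i.+1 1.
    by rewrite -a_top; congr h; lia.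
  have -> : h i 2 = profile_head c 2 by apply: hi2; lia.
  by rewrite b_top; lia.
have b_i : h i 2 = profile_head c 2 by apply: hi2; lia.
have b_le := gr_mono _ _ hG i 2; rewrite b_i in b_le ab2.
have [c' [c'0 c'1 c'2]] : exists c', [/\ profile_head c' 0 = 1, profile_head c' 1 = h i.+1 1 &
    profile_head c' 2 = h i.+1 2].
  move: a_gt1 a_le b_le ab1 ab2; rewrite hi1.
  move: (h i.+1 1) (h i.+1 2) => a b; case: (c) cZ => //= _ ? ? ? ? ?.
  - have [[-> ->]|[[-> ->]|[[-> ->]|[-> ->]]]] : (a = 3 /\ b = 4) \/
      (a = 3 /\ b = 3) \/ (a = 2 /\ b = 3) \/ (a = 2 /\ b = 2) by lia.
    + by exists P134. + by exists P133. + by exists P123. + by exists P122.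
  - have [[-> ->]|[-> ->]] : (a = 3 /\ b = 3) \/ (a = 2 /\ b = 2) by lia.
    + by exists P133. + by exists P122.
  - have [[-> ->]|[-> ->]] : (a = 2 /\ b = 3) \/ (a = 2 /\ b = 2) by lia.
    + by exists P123. + by exists P122.
  - have [-> ->] : (a = 2 /\ b = 2) by lia. by exists P122.
  - lia.
exists c' => d le_d.
have [->|[->|[->|[->|[d1 d2]]]]] : d = 0 \/ d = 1 \/ d = j - i.+1 \/
    d = (j - i.+1).-1 \/ 1 < d /\ d + 2 <= j - i.+1 by lia.
- by rewrite profile_rank0 e1.
- by rewrite profile_rank1.
- by rewrite etop e1 profile_rankr.
- by rewrite a_top profile_rank1r.
- by rewrite profile_rank2 // mid.
Qed.

Lemma ranks_has_profile i : i <= j -> has_profile i.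
Proof.
elim: i => [|i IH] le_ij; last by apply: has_profile_step => //; apply: IH; lia.
by exists P134 => d le_d; rewrite subn0 ranks0.
Qed.

End Shape.

(** * Classification of the tables *)

Definition table_of j (h : nat -> nat -> nat) (n : nat) : Prop :=
  forall i d, d <= 2 -> i + d.*2 <= j -> h i d = profile_head (column_profile j n i) d.

Lemma table_unique j h h' n : 3 < j -> gor_ranks j h -> gor_ranks j h' ->
  table_of j h n -> table_of j h' n -> forall i d, h i d = h' i d.
Proof.
move=> j3 hG hG' hn hn' i d.
have [le_ij|lt_ji] := leqP (i + d) j; last first.
  by rewrite (gr_out _ _ hG) ?(gr_out _ _ hG').
have le_i : i <= j by lia.
have [c hc] := ranks_has_profile _ _ j3 hG i le_i.
have [c' hc'] := ranks_has_profile _ _ j3 hG' i le_i.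
rewrite hc // hc' // /profile_rank.
have hd m : m <= 2 -> i + m.*2 <= j -> profile_head c m = profile_head c' m.
  move=> m2 mj; have := hn i m m2 mj; rewrite -(hn' i m m2 mj) hc ?hc'; try lia.
  by rewrite /profile_rank (_ : minn 2 _ = m) //; lia.
by apply: hd; lia.
Qed.

Section Classify.
Variables (j : nat) (h : nat -> nat -> nat).
Hypotheses (j_gt3 : 3 < j) (hG : gor_ranks j h).

(** The content of a profile in the form used by linear arithmetic: the entries in
    degrees at most 3, each with the column length for which it is valid. *)
Lemma column_values i : i <= j -> exists c,
  [/\ h i 0 = profile_head c 0, i + 2 <= j -> h i 1 = profile_head c 1,
      i + 4 <= j -> h i 2 = profile_head c 2,
      i + 5 <= j -> h i 3 = profile_head c 2 &
      [/\ i + 4 = j -> h i 3 = profile_head c 1, i + 3 = j -> h i 2 = profile_head c 1 &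
       [/\ i + 3 = j -> h i 3 = profile_head c 0, i + 2 = j -> h i 2 = profile_head c 0 &
          i + 1 = j -> h i 1 = profile_head c 0]]].
Proof.
move=> le_ij; have [c hc] := ranks_has_profile _ _ j_gt3 hG i le_ij.
by exists c; repeat split=> *; rewrite hc; rewrite /profile_rank;
  try (congr profile_head); lia.
Qed.

(** Convexity between three columns: when the first two agree, the third cannot be
    smaller as long as degree 3 still lies in the middle of the columns. *)
Lemma equal_columns_step i : i + 6 <= j -> (forall d, d <= 2 -> h i.+1 d = h i d) ->
  forall d, d <= 2 -> h i.+2 d = h i.+1 d.
Proof.
move=> ij e.
have c0 := gr_conv _ _ hG i 0; have c1 := gr_conv _ _ hG i 1.
have c2 := gr_conv _ _ hG i 2.
have [c [? ? ? ? _]] := column_values i ltac:(lia).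
have [c' [? ? ? ? _]] := column_values i.+1 ltac:(lia).
have := gr_mono _ _ hG i.+1.
have := e 0 isT; have := e 1 isT; have := e 2 isT.
move=> e2 e1 e0 m [|[|[|//]]] _; have := m 0; have := m 1; have := m 2; lia.
Qed.

Lemma equal_columns i m : (forall d, d <= 2 -> h i.+1 d = h i d) ->
  i + m + 4 <= j -> forall d, d <= 2 -> h (i + m) d = h i d.
Proof.
move=> e; suff H k : i + k + 5 <= j -> forall d, d <= 2 ->
    h (i + k).+1 d = h (i + k) d.
  elim: m => [|m IH] ij d d2; first by rewrite addn0.
  by rewrite addnS H ?IH; lia.
elim: k => [|k IH] ij; first by rewrite addn0.
by rewrite addnS; apply: equal_columns_step; [lia | apply: IH; lia].
Qed.

End Classify.

Section Classify.
Variables (j : nat) (h : nat -> nat -> nat).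
Hypotheses (j_gt3 : 3 < j) (hG : gor_ranks j h).
Let C := column_values _ _ j_gt3 hG.
Let cv := gr_conv _ _ hG.
Let mo := gr_mono _ _ hG.

Lemma profile_head_le12 c : profile_head c 1 <= profile_head c 2. Proof. by case: c. Qed.

(** A drop from 1 to 0 of the first entries would violate convexity in degree 0,
    since the second entries are 1 as well. *)
Lemma ones_persist i m : h i 0 = 1 -> h i 1 = 1 -> h i.+1 0 = 1 -> i + 2 <= j ->
  i + m <= j -> h (i + m) 0 = 1.
Proof.
move=> i0 i1 i2 ij.
suff H k : i + k + 1 <= j -> [/\ h (i + k) 0 = 1, h (i + k).+1 0 = 1 &
   h (i + k) 1 = 1].
  case: m => [|m] hm; first by rewrite addn0.
  by rewrite addnS; case: (H m ltac:(lia)).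
elim: k => [|k IH] hk; first by rewrite addn0.
have [|a b c] := IH; first lia.
rewrite addnS.
have [c1 [_ ? _ _ [_ _ [_ _ ?]]]] := C (i + k).+1 ltac:(lia).
have [c2 [_ ? _ _ [_ _ [_ _ ?]]]] := C (i + k) ltac:(lia).
have := cv (i + k) 0; have := mo (i + k).+1 0; have := mo (i + k) 1.
have := ranks_gt0 j h j_gt3 hG (i + k).+1 1 ltac:(lia) ltac:(lia); split; lia.
Qed.

Lemma zeros_persist i i' d : h i 0 = 0 -> i <= i' -> h i' d = 0.
Proof.
move=> z /subnKC <-; apply: (ranks_zero_column _ _ hG).
by elim: (i' - i) => [|m IH]; rewrite ?addn0 // addnS; have := mo (i + m) 0; lia.
Qed.

(** The analogue of [ones_persist] in degree 1: a profile (1,2,..,2,1) that has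
    been repeated once in degree 1 is kept until its length is too short. *)
Lemma twos_persist i m : h i 1 = 2 -> h i.+1 1 = 2 -> h i 2 = 2 -> i + 4 <= j ->
  i + m + 2 <= j -> h (i + m) 1 = 2 /\ (i + m + 4 <= j -> h (i + m) 2 = 2).
Proof.
move=> i0 i1 i2 ij.
suff H k : i + k + 3 <= j -> [/\ h (i + k) 1 = 2, h (i + k).+1 1 = 2 &
    h (i + k) 2 = 2].
  case: m => [|m] hm; first by rewrite addn0.
  rewrite addnS; case: (H m ltac:(lia)) => a b c; split=> // hm'.
  by case: (H m.+1 ltac:(lia)); rewrite addnS.
elim: k => [|k IH] hk; first by rewrite addn0.
have [|a b c] := IH; first lia.
rewrite addnS.
have [c1 [_ ? ? _ [_ ? _]]] := C (i + k).+1 ltac:(lia).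
have := cv (i + k) 1; have := mo (i + k).+1 1; have := mo (i + k) 2.
have := profile_head_le12 c1; split; lia.
Qed.
End Classify.

(** Checks that a table agrees with a sequence of profiles, column by column, from
    hypotheses that give the entries of each range of columns. *)
Ltac by_profiles i :=
  move=> i [|[|[|//]]] _ ?; rewrite /column_profile /=; splitif;
  repeat match goal with
  | F : forall k : nat, _ -> _ |- _ => move: (F i) => {F}
  end; lia.

Section Classify.
Variables (j : nat) (h : nat -> nat -> nat).
Hypotheses (hG : gor_ranks j h).
Let cv := gr_conv _ _ hG.
Let mo := gr_mono _ _ hG.

Lemma column0 : 5 < j -> [/\ h 0 0 = 1, h 0 1 = 3, h 0 2 = 4 & h 0 3 = 4].
Proof.
move=> j5; have j3 : 3 < j by lia.
by split; rewrite (ranks0 _ _ j3 hG) ?profile_rank0 ?profile_rank1 ?profile_rank2 //; lia.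
Qed.

Lemma ones_phase i0 : 3 < j -> h i0 0 = 1 -> h i0 1 = 1 -> h i0.+1 0 = 1 ->
  i0 + 2 <= j -> forall i, i0 <= i /\ i <= j ->
  h i 0 = 1 /\ (i + 2 <= j -> h i 1 = 1) /\ (i + 4 <= j -> h i 2 = 1).
Proof.
move=> j3 h0 h1 h2 hj i [hi hij].
have e0 : h i 0 = 1.
  by have := ones_persist _ _ j3 hG i0 (i - i0) h0 h1 h2 hj; rewrite subnKC //; apply.
have a1 : h i 1 <= 1.
  move: (subnKC hi) => <-; elim: (i - i0) => [|m IH]; first by rewrite addn0 h1.
  by rewrite addnS; have := mo (i0 + m) 1; lia.
have b1 := ranks_le1 _ _ j3 hG i 1 a1.
have p1 := ranks_gt0 _ _ j3 hG i 1 ltac:(lia).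
have p2 := ranks_gt0 _ _ j3 hG i 2 ltac:(lia).
by repeat split; [exact: e0|lia|lia].
Qed.

Lemma twos_phase i0 : 3 < j -> h i0 1 = 2 -> h i0.+1 1 = 2 -> h i0 2 = 2 ->
  i0 + 4 <= j -> forall i, i0 <= i /\ i + 2 <= j ->
  h i 0 = 1 /\ h i 1 = 2 /\ (i + 4 <= j -> h i 2 = 2).
Proof.
move=> j3 h0 h1 h2 hj i [hi hij].
have := twos_persist _ _ j3 hG i0 (i - i0) h0 h1 h2 hj; rewrite subnKC // => tw.
have [a2 b2] := tw hij; split=> //.
have [z|] := posnP (h i 0); first by move: a2; rewrite (ranks_zero_column _ _ hG _ _ z).
have [c [-> _ _ _ _]] := column_values _ _ j3 hG i ltac:(lia).
by case: (c).
Qed.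

(** The profiles allowed for columns 1 and 2 when j > 5. *)
Definition start_pair (c1 c2 : profile) : bool :=
  match c1, c2 with
  | P134, P134 | P133, P133 | P133, P122 | P123, P123 | P123, P122 | P122, P122
  | P122, P111 | P122, P000 | P111, P111 | P111, P000 => true
  | _, _ => false
  end.

Lemma classify_start : 5 < j -> exists c1 c2, start_pair c1 c2 /\
  forall d, d <= 2 -> h 1 d = profile_head c1 d /\ h 2 d = profile_head c2 d.
Proof.
move=> j5; have j3 : 3 < j by lia.
have [h00 h01 h02 h03] := column0 j5.
have [c1 [v10 v11 v12 v13 _]] := column_values _ _ j3 hG 1 ltac:(lia).
have [c2 [v20 v21 v22 _ _]] := column_values _ _ j3 hG 2 ltac:(lia).
exists c1, c2; split; last first.
  by case=> [|[|[|//]]] _; split=> //; [apply: v11|apply: v21|apply: v12|apply: v22]; lia.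
have {}v11 := v11 ltac:(lia); have {}v12 := v12 ltac:(lia).
have {}v13 := v13 ltac:(lia); have {}v21 := v21 ltac:(lia).
have {}v22 := v22 ltac:(lia).
have h10 := gr_lin _ _ hG.
have slope : h 1 2 <= h 2 2 + (j - 4).+1 -> h 1 1 + h 2 2 <= h 1 2 + h 2 1.
  have := gr_growth _ _ hG 1 (j - 4).
  have -> : h 1 (j - 4).+2 = h 1 1.
    by rewrite (gr_sym _ _ hG); [congr h|]; lia.
  have -> : h 1 (j - 4).+1 = h 1 2.
    by rewrite (gr_sym _ _ hG); [congr h|]; lia.
  have -> : h 2 (j - 4).+1 = h 2 1.
    by rewrite (gr_sym _ _ hG); [congr h|]; lia.
  by have -> : h 2 (j - 4) = h 2 2 by rewrite (gr_sym _ _ hG); [congr h|]; lia.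
move: (cv 0 0) (cv 0 1) (cv 0 2) (mo 1 0) (mo 1 1) (mo 1 2) slope.
rewrite ?h00 ?h01 ?h02 ?h03 v10 v11 v12 v13 v20 v21 v22; rewrite v10 in h10.
move: j5 h10; clear; case: c1; case: c2 => //= ; lia.
Qed.

(** In the last columns every entry is at distance at most 1 from an end, so that
    two numbers describe a column. *)
Lemma tail3 : 5 < j -> exists e a, [/\ h (j - 3) 0 = e, h (j - 3) 1 = a, h (j - 3) 2 = a &
  (e, a) \in [:: (1, 3); (1, 2); (1, 1); (0, 0)]].
Proof.
move=> j5; have j3 : 3 < j by lia.
have [c [r0 r1 _ _ [_ r2 _]]] := column_values _ _ j3 hG (j - 3) ltac:(lia).
by exists (profile_head c 0), (profile_head c 1); split; [|apply: r1; lia|apply: r2; lia|case: (c)].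
Qed.

Lemma tail2 : 5 < j -> exists e a, [/\ h (j - 2) 0 = e, h (j - 2) 1 = a &
  (e, a) \in [:: (1, 3); (1, 2); (1, 1); (0, 0)]].
Proof.
move=> j5; have j3 : 3 < j by lia.
have [c [r0 r1 _ _ _]] := column_values _ _ j3 hG (j - 2) ltac:(lia).
by exists (profile_head c 0), (profile_head c 1); split; [|apply: r1; lia|case: (c)].
Qed.

Lemma tail1 : 5 < j -> exists2 e, h (j - 1) 0 = e /\ h (j - 1) 1 = e & e <= 1.
Proof.
move=> j5; have j3 : 3 < j by lia.
have [c [r0 _ _ _ [_ _ [_ _ r1]]]] := column_values _ _ j3 hG (j - 1) ltac:(lia).
by exists (profile_head c 0); [split; [|apply: r1; lia]|case: (c)].
Qed.

Lemma rank0_le1 i : 5 < j -> i <= j -> h i 0 <= 1.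
Proof.
move=> j5 hi; have j3 : 3 < j by lia.
by have [c [-> _ _ _ _]] := column_values _ _ j3 hG i hi; case: (c).
Qed.

Lemma gr_conv_at i0 i1 i2 d : i1 = i0.+1 -> i2 = i0.+2 ->
  h i1 d + h i1 d.+1 <= h i0 d.+1 + h i2 d.
Proof. by move=> -> ->. Qed.

Lemma gr_mono_at i0 i1 d : i1 = i0.+1 -> h i1 d <= h i0 d.
Proof. by move=> ->. Qed.

(** Equal columns 1 and 2 are repeated up to column j - 4; the last four columns
    are then enumerated, convexity excluding all but fourteen continuations. *)
Lemma classify_equal_start c : 5 < j -> start_pair c c ->
  (forall d, d <= 2 -> h 1 d = profile_head c d /\ h 2 d = profile_head c d) ->
  exists2 n, 0 < n < 27 & table_of j h n.
Proof.
move=> j5 cc hc; have j3 : 3 < j by lia.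
have S i : 0 < i /\ i + 4 <= j ->
    h i 0 = profile_head c 0 /\ h i 1 = profile_head c 1 /\ h i 2 = profile_head c 2.
  move=> hi; have st : forall d, d <= 2 -> h 2 d = h 1 d.
    by move=> d d2; case: (hc d d2) => -> ->.
  have := equal_columns _ _ j3 hG 1 (i - 1) st ltac:(lia).
  rewrite subnKC; last by lia.
  by move=> E; rewrite !E // !(proj1 (hc _ _)).
have S4 := S (j - 4) ltac:(lia); have S5 := S (j - 5) ltac:(lia).
have K51 := gr_conv_at (j - 5) (j - 4) (j - 3) 1 ltac:(lia) ltac:(lia).
have K40 := gr_conv_at (j - 4) (j - 3) (j - 2) 0 ltac:(lia) ltac:(lia).
have K41 := gr_conv_at (j - 4) (j - 3) (j - 2) 1 ltac:(lia) ltac:(lia).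
have K30 := gr_conv_at (j - 3) (j - 2) (j - 1) 0 ltac:(lia) ltac:(lia).
have K20 := gr_conv_at (j - 2) (j - 1) j 0 ltac:(lia) ltac:(lia).
have mo40 := gr_mono_at (j - 4) (j - 3) 0 ltac:(lia).
have mo41 := gr_mono_at (j - 4) (j - 3) 1 ltac:(lia).
have mo30 := gr_mono_at (j - 3) (j - 2) 0 ltac:(lia).
have mo31 := gr_mono_at (j - 3) (j - 2) 1 ltac:(lia).
have mo20 := gr_mono_at (j - 2) (j - 1) 0 ltac:(lia).
have mo10 := gr_mono_at (j - 1) j 0 ltac:(lia).
have eJ := rank0_le1 j j5 (leqnn j).
have [e3 [a3 [t30 t31 t32 ea3]]] := tail3 j5.
have [e2 [a2 [t20 t21 ea2]]] := tail2 j5.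
have [e1 [t10 t11] ea1] := tail1 j5.
have F3 i : i + 3 = j -> h i 0 = e3 /\ h i 1 = a3.
  by move=> e; rewrite (_ : i = j - 3) //; lia.
have F4 i : i + 2 = j -> h i 0 = e2 /\ h i 1 = a2.
  by move=> e; rewrite (_ : i = j - 2) //; lia.
have F5 i : i + 1 = j -> h i 0 = e1.
  by move=> e; rewrite (_ : i = j - 1) //; lia.
have [e0 Ee0] : exists e, h j 0 = e by eexists.
have F6 i : i = j -> h i 0 = e0 by move=> ->.
rewrite ?t10 ?t11 ?t20 ?t21 ?t30 ?t31 ?t32 ?Ee0 in K51 K40 K41 K30 K20 mo40 mo41 mo30 mo31 mo20 mo10 eJ.
case: S4 => S40 [S41 S42]; case: S5 => S50 [S51 S52].
rewrite ?S40 ?S41 ?S42 ?S50 ?S51 ?S52 in K51 K40 K41 mo40 mo41.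
have [h00 h01 h02 h03] := column0 j5.
have F0 i : i = 0 -> h i 0 = 1 /\ h i 1 = 3 /\ h i 2 = 4 by move=> ->.
clear hc cv mo t10 t11 t20 t21 t30 t31 t32 Ee0 S40 S41 S42 S50 S51 S52 h00 h01 h02 h03.
move: ea3; rewrite !inE => /or4P[] /eqP[??]; subst e3 a3;
move: ea2; rewrite !inE => /or4P[] /eqP[??]; subst e2 a2;
case: e1 ea1 F5 K30 K20 mo20 mo10 => [|[|//]] _ F5 K30 K20 mo20 mo10;
case: e0 eJ F6 K20 mo10 => [|[|//]] _ F6 K20 mo10;
case: c cc S K51 K40 K41 mo40 mo41 => //= _ S K51 K40 K41 mo40 mo41; try lia.
all: clear -S F0 F3 F4 F5 F6 j5.
1: exists 13. 3: exists 14. 5: exists 1. 7: exists 2. 9: exists 20. 11: exists 15.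
13: exists 3. 15: exists 16. 17: exists 19. 19: exists 4. 21: exists 7.
23: exists 21. 25: exists 8. 27: exists 12.
all: try by [].
all: by_profiles i.
Qed.

(** When columns 1 and 2 differ, the table falls quickly to columns (1,2,..,2,1),
    (1,..,1) or 0, each of which persists once it has been repeated. *)
Lemma classify_distinct_start c c' : 5 < j -> start_pair c c' -> c <> c' ->
  (forall d, d <= 2 -> h 1 d = profile_head c d /\ h 2 d = profile_head c' d) ->
  exists2 n, 0 < n < 27 & table_of j h n.
Proof.
move=> j5 cc c_neq hc; have j3 : 3 < j by lia.
have [h00 h01 h02 h03] := column0 j5.
have F0 i : i = 0 -> h i 0 = 1 /\ h i 1 = 3 /\ h i 2 = 4 by move=> ->.
have F1 i : i = 1 -> h i 0 = profile_head c 0 /\ h i 1 = profile_head c 1 /\ h i 2 = profile_head c 2.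
  by move=> ->; rewrite !(proj1 (hc _ _)).
have F2 i : i = 2 -> h i 0 = profile_head c' 0 /\ h i 1 = profile_head c' 1 /\ h i 2 = profile_head c' 2.
  by move=> ->; rewrite !(proj2 (hc _ _)).
have ZG i0 : h i0 0 = 0 -> forall i, i0 <= i -> h i 0 = 0 /\ h i 1 = 0 /\ h i 2 = 0.
  by move=> z i hi; rewrite !(zeros_persist _ _ j3 hG _ _ _ z hi).
have [h20 h21 h22] : [/\ h 2 0 = profile_head c' 0, h 2 1 = profile_head c' 1 & h 2 2 = profile_head c' 2].
  by rewrite !(proj2 (hc _ _)).
have [h10 h11 h12] : [/\ h 1 0 = profile_head c 0, h 1 1 = profile_head c 1 & h 1 2 = profile_head c 2].
  by rewrite !(proj1 (hc _ _)).
have K1 := cv 1 1; have m2 := mo 2 1; have eJ := rank0_le1 j j5 (leqnn j).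
have e3 := rank0_le1 3 j5 ltac:(lia); have e4 := rank0_le1 4 j5 ltac:(lia).
have FJ i : i = j -> h i 0 = h j 0 by move=> ->.
have FJ1 i : i + 1 = j -> h i 0 = h (j - 1) 0.
  by move=> e; rewrite (_ : i = j - 1) //; lia.
have after_P122 : c' = P122 -> h 3 1 = 2 \/ h 3 1 = 1 /\ h 3 0 = 1.
  move=> Ec'; subst c'; have : profile_head c 2 <= 3 by case: (c) cc.
  have : 0 < h 3 1 -> h 3 0 = 1.
    by move=> p; have := ranks_zero_column _ _ hG 3 1; lia.
  by rewrite /= in h20 h21 h22; clear -h12 h21 h22 K1 m2; lia.
case: c' cc c_neq hc F2 h20 h21 h22 after_P122; case: (c) F1 h10 h11 h12 => //=;
 move=> F1 h10 h11 h12 _ _ hc F2 h20 h21 h22 after_P122.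
1,2: have [a3|[a3 b3]] := after_P122 erefl.
(* Column 3 repeats (1,2,..,2,1), and so do the later ones. *)
1,3: have T := twos_phase 2 j3 h21 a3 h22 ltac:(lia).
1,2: have := T (j - 2) ltac:(lia); have := T (j - 3) ltac:(lia) => T3 T2;
     have := gr_conv_at (j - 3) (j - 2) (j - 1) 0 ltac:(lia) ltac:(lia);
     have := rank0_le1 (j - 1) j5 ltac:(lia) => ? ?;
     have {}FJ1 i : i + 1 = j -> h i 0 = 1 by move=> /FJ1; lia.
1,2: clear -F0 F1 F2 FJ FJ1 T eJ j5;
     case: (h j 0) eJ FJ => [|[|//]] _ FJ.
1: exists 17. 3: exists 5. 5: exists 18. 7: exists 6.
1,3,5,7: by [].
1-4: by_profiles i.
(* Column 3 is (1,..,1): either column 4 is zero or the ones persist. *)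
1,2: have F3 i : i = 3 -> h i 0 = 1 /\ h i 1 = 1 /\ (i + 4 <= j -> h i 2 = 1).
1,3: move=> ->; split=> //; split=> // j7;
     have := ranks_le1 _ _ j3 hG 3 1 ltac:(lia);
     have := ranks_gt0 _ _ j3 hG 3 2 ltac:(lia) ltac:(lia); clear; lia.
1,2: have [e40|e41] : h 4 0 = 0 \/ h 4 0 = 1 by clear -e4; lia.
1,3: have := ZG 4 e40 => Z4; clear -F0 F1 F2 F3 Z4 j5.
1: exists 22. 3: exists 23.
1,3: by [].
1,2: by_profiles i.
1,2: have := ones_phase 3 j3 b3 a3 e41 ltac:(lia) => O3; clear -F0 F1 F2 O3 j5.
1: exists 9. 3: exists 10.
1,3: by [].
1,2: by_profiles i.
(* Column 1 is (1,2,..,2,1) and column 2 is (1,..,1). *)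
- have [e30|e31] : h 3 0 = 0 \/ h 3 0 = 1 by clear -e3; lia.
    by have := ZG 3 e30 => Z3; clear -F0 F1 F2 Z3 j5; exists 24 => //; by_profiles i.
  have := ones_phase 2 j3 h20 h21 e31 ltac:(lia) => O2.
  by clear -F0 F1 F2 O2 j5; exists 11 => //; by_profiles i.
- by have := ZG 2 h20 => Z2; clear -F0 F1 Z2 j5; exists 25 => //; by_profiles i.
- by have := ZG 2 h20 => Z2; clear -F0 F1 Z2 j5; exists 26 => //; by_profiles i.
Qed.

Lemma classify_big : 5 < j -> exists2 n, 0 < n < 27 & table_of j h n.
Proof.
move=> j5; have [c [c' [cc' hc]]] := classify_start j5.
have [e|ne] : c = c' \/ c <> c' by case: (c); case: (c'); auto; right.
  by subst c'; apply: classify_equal_start cc' _.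
exact: classify_distinct_start cc' ne _.
Qed.

End Classify.

Section Classify.
Variables (j : nat) (h : nat -> nat -> nat).
Hypotheses (hG : gor_ranks j h).
Let cv := gr_conv _ _ hG.
Let mo := gr_mono _ _ hG.

(** When j is 4 or 5 almost all the columns end in degree 3 or before, and two
    numbers describe such a column. *)
Lemma tail_values i : 3 < j -> i <= j -> exists e a, [/\ h i 0 = e, i + 2 <= j -> h i 1 = a,
  i + 3 = j -> h i 2 = a /\ h i 3 = e, i + 2 = j -> h i 2 = e /\ (i + 1 = j -> h i 1 = e) &
  (e, a) \in [:: (1, 3); (1, 2); (1, 1); (0, 0)]].
Proof.
move=> j3 hi.
have [c [r0 r1 _ _ [_ r2 [r3 r4 r5]]]] := column_values _ _ j3 hG i hi.
by exists (profile_head c 0), (profile_head c 1); split=> // *; [split; auto|split; auto|case: (c)].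
Qed.

Lemma classify5 : j = 5 -> exists2 n, 0 < n < 27 & table_of j h n.
Proof.
move=> j5; have j3 : 3 < j by lia.
have [c0 [_ _ _ z3 _]] := column_values _ _ j3 hG 0 ltac:(lia).
have z i : i <= j -> h 0 i = profile_rank P134 j i by move=> hi; apply: (ranks0 _ _ j3 hG).
have [c1 [v10 v11 v12 _ [v13 _ _]]] := column_values _ _ j3 hG 1 ltac:(lia).
have {}v11 := v11 ltac:(lia); have {}v12 := v12 ltac:(lia).
have {}v13 := v13 ltac:(lia).
have [e2 [a2 [v20 v21 v22 _ ea2]]] := tail_values 2 j3 ltac:(lia).
have [e3 [a3 [v30 v31 _ v32 ea3]]] := tail_values 3 j3 ltac:(lia).
have {}v21 := v21 ltac:(lia); have [{}v22 v23] := v22 ltac:(lia).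
have {}v31 := v31 ltac:(lia); have [{}v32 _] := v32 ltac:(lia).
have [e4 [v40 v41 e4_le]] : exists e, [/\ h 4 0 = e, h 4 1 = e & e <= 1].
  have [c [r0 _ _ _ [_ _ [_ _ r5]]]] := column_values _ _ j3 hG 4 ltac:(lia).
  by exists (profile_head c 0); split; [|apply: r5; lia|case: (c)].
have [e5 [v50 e5_le]] : exists e, h 5 0 = e /\ e <= 1.
  have [c [r0 _ _ _ _]] := column_values _ _ j3 hG 5 ltac:(lia).
  by exists (profile_head c 0); split => //; case: (c).
have v10' := gr_lin _ _ hG; rewrite v10 in v10'.
have [v00 v01 v02 v03] : [/\ h 0 0 = 1, h 0 1 = 3, h 0 2 = 4 & h 0 3 = 4].
  by rewrite !z ?profile_rank0 ?profile_rank1 ?profile_rank2 //; lia.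
move: (cv 0 0) (cv 0 1) (cv 0 2) (cv 1 0) (cv 1 1) (cv 2 0) (cv 3 0).
move: (mo 1 0) (mo 1 1) (mo 1 2) (mo 2 0) (mo 2 1) (mo 3 0) (mo 4 0).
have := gr_growth _ _ hG 1 0.
rewrite ?v00 ?v01 ?v02 ?v03 ?v10 ?v11 ?v12 ?v13 ?v20 ?v21 ?v22 ?v23 ?v30 ?v31 ?v32
  ?v40 ?v41 ?v50 => g m1 m2 m3 m4 m5 m6 m7 k1 k2 k3 k4 k5 k6 k7.
have F0 i : i = 0 -> h i 0 = 1 /\ h i 1 = 3 /\ h i 2 = 4 by move=> ->.
have F1 i : i = 1 -> h i 0 = profile_head c1 0 /\ h i 1 = profile_head c1 1 /\ h i 2 = profile_head c1 2.
  by move=> ->.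
have F2 i : i = 2 -> h i 0 = e2 /\ h i 1 = a2 by move=> ->.
have F3 i : i = 3 -> h i 0 = e3 /\ h i 1 = a3 by move=> ->.
have F4 i : i = 4 -> h i 0 = e4 by move=> ->.
have F5 i : i = 5 -> h i 0 = e5 by move=> ->.
clear -g m1 m2 m3 m4 m5 m6 m7 k1 k2 k3 k4 k5 k6 k7 F0 F1 F2 F3 F4 F5 j5 ea2 ea3 e4_le e5_le v10'.
subst j.
case: e4 e4_le F4 m6 m7 k6 k7 => [|[|//]] _ F4 m6 m7 k6 k7;
case: e5 e5_le F5 m7 k7 => [|[|//]] _ F5 m7 k7; try (exfalso; clear -m7; lia);
move: ea3; rewrite !inE => /or4P[] /eqP[??]; subst e3 a3;
 try (exfalso; clear -m7 k7 m6 k6; lia);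
move: ea2; rewrite !inE => /or4P[] /eqP[??]; subst e2 a2;
 try (exfalso; clear -m4 m5 m6 k6; lia);
case: c1 v10' F1 g m1 m2 m3 k1 k2 k3 k4 k5 => //= _ F1 g m1 m2 m3 k1 k2 k3 k4 k5;
 try (exfalso; clear -g m1 m2 m3 k1 k2 k3 k4 k5; lia).
all: clear -F0 F1 F2 F3 F4 F5.
1: exists 20. 3: exists 22. 5: exists 21. 7: exists 24. 9: exists 25. 11:
exists 26. 13: exists 13. 15: exists 14. 17: exists 15. 19: exists 17. 21:
exists 16. 23: exists 19. 25: exists 1. 27: exists 2. 29: exists 3. 31: exists
5. 33: exists 4. 35: exists 7. 37: exists 9. 39: exists 8. 41: exists 11. 43:
exists 12.
all: try by [].
all: by_profiles i.
Qed.

Lemma classify4 : j = 4 -> exists2 n, n \in short_types & table_of j h n.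
Proof.
move=> j4; have j3 : 3 < j by lia.
have [c0 [_ _ _ _ _]] := column_values _ _ j3 hG 0 ltac:(lia).
have z i : i <= j -> h 0 i = profile_rank P134 j i by move=> hi; apply: (ranks0 _ _ j3 hG).
have [e1 [a1 [v10 v11 v12 _ ea1]]] := tail_values 1 j3 ltac:(lia).
have [e2 [a2 [v20 v21 _ v22 ea2]]] := tail_values 2 j3 ltac:(lia).
have {}v11 := v11 ltac:(lia); have [{}v12 v13] := v12 ltac:(lia).
have {}v21 := v21 ltac:(lia); have [{}v22 _] := v22 ltac:(lia).
have [e3 [v30 v31 e3_le]] : exists e, [/\ h 3 0 = e, h 3 1 = e & e <= 1].
  have [c [r0 _ _ _ [_ _ [_ _ r5]]]] := column_values _ _ j3 hG 3 ltac:(lia).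
  by exists (profile_head c 0); split; [|apply: r5; lia|case: (c)].
have [e4 [v40 e4_le]] : exists e, h 4 0 = e /\ e <= 1.
  have [c [r0 _ _ _ _]] := column_values _ _ j3 hG 4 ltac:(lia).
  by exists (profile_head c 0); split => //; case: (c).
have v10' : 0 < e1 by rewrite -v10 (gr_lin _ _ hG).
have [v00 v01 v02 v03] : [/\ h 0 0 = 1, h 0 1 = 3, h 0 2 = 4 & h 0 3 = 3].
  by rewrite !z ?j4 //.
move: (cv 0 0) (cv 0 1) (cv 0 2) (cv 1 0) (cv 1 1) (cv 2 0).
move: (mo 1 0) (mo 1 1) (mo 1 2) (mo 2 0) (mo 2 1) (mo 3 0).
have := gr_growth _ _ hG 1 0.
rewrite ?v00 ?v01 ?v02 ?v03 ?v10 ?v11 ?v12 ?v13 ?v20 ?v21 ?v22 ?v30 ?v31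
  ?v40 => g m1 m2 m3 m4 m5 m6 k1 k2 k3 k4 k5 k6.
have F0 i : i = 0 -> h i 0 = 1 /\ h i 1 = 3 /\ h i 2 = 4 by move=> ->.
have F1 i : i = 1 -> h i 0 = e1 /\ h i 1 = a1 by move=> ->.
have F2 i : i = 2 -> h i 0 = e2 /\ h i 1 = a2 by move=> ->.
have F3 i : i = 3 -> h i 0 = e3 by move=> ->.
have F4 i : i = 4 -> h i 0 = e4 by move=> ->.
clear -g m1 m2 m3 m4 m5 m6 k1 k2 k3 k4 k5 k6 F0 F1 F2 F3 F4 j4 ea2 ea1 e3_le e4_le v10'.
subst j.
case: e3 e3_le F3 m4 m5 m6 k4 k5 k6 => [|[|//]] _ F3 m4 m5 m6 k4 k5 k6;
case: e4 e4_le F4 m6 k6 => [|[|//]] _ F4 m6 k6; try (exfalso; clear -m6; lia);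
move: ea2; rewrite !inE => /or4P[] /eqP[??]; subst e2 a2;
 try (exfalso; clear -m4 m5 k6; lia);
move: ea1; rewrite !inE => /or4P[] /eqP[??]; subst e1 a1;
 try (exfalso; clear -v10' g m1 m2 m3 m4 m5 m6 k1 k2 k3 k4 k5 k6; lia).
all: clear -F0 F1 F2 F3 F4.
1: exists 20. 3: exists 24. 5: exists 25. 7: exists 26. 9: exists 13. 11:
exists 15. 13: exists 19. 15: exists 1. 17: exists 3. 19: exists 7. 21: exists
8. 23: exists 12.
all: try by [].
all: by_profiles i.
Qed.
End Classify.

(** * From the table back to the type *)

(** The second difference of the ranks at ([p], [nu]) is the number of strings of
    length [p] starting in degree [nu]; the case [nu = 0] has no previous
    degree. *)
Lemma count_string_rank s p nu : 0 < p -> all (fun x => 0 < x.1) s ->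
  count_mem (p, nu) s + (if nu is m.+1 then string_rank s p m else 0) + string_rank s p nu =
  string_rank s p.-1 nu + (if nu is m.+1 then string_rank s p.+1 m else 0).
Proof.
move=> p0; case: nu => [|m]; rewrite /string_rank; elim: s => //= -[q mu] s IH /= /andP[q0 /IH];
 rewrite xpair_eqE; repeat match goal with |- context [count ?f s] => move: (count f s) => ? end; lia.
Qed.

Lemma perm_of_string_ranks s t : all (fun x => 0 < x.1) s -> all (fun x => 0 < x.1) t ->
  (forall i d, string_rank s i d = string_rank t i d) -> perm_eq s t.
Proof.
move=> s0 t0 e; apply/permP => a.
suff cm x : count_mem x s = count_mem x t.
  by move/permP: (introT allP (fun x _ => introT eqP (cm x)) : perm_eq s t); apply.
case: x => -[|p] nu.
  have z u : all (fun x : nat * nat => 0 < x.1) u -> count_mem (0, nu) u = 0.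
    by move=> /allP u0; apply/count_memPn/negP => /u0.
  by rewrite !z.
have := count_string_rank s p.+1 nu isT s0; have := count_string_rank t p.+1 nu isT t0.
by case: nu => [|m]; rewrite !e /=;
 repeat match goal with |- context [count ?f ?u] => move: (count f u) => ? end; lia.
Qed.

Lemma jdt_seq_pos j n : 3 < j -> all (fun x => 0 < x.1) (jdt_seq j n).
Proof.
move=> j3; have aa p l : 0 < p -> all (fun x : nat * nat => 0 < x.1) (at_ p l).
  by move=> p0; rewrite /at_ all_map; apply/allP => ? _ /=.
do 27?[case: n => [|n]] => //;
 cbv beta iota delta [jdt_seq pow up]; rewrite /= ?cats0 ?all_cat ?aa //= ?all_cat ?aa //=; lia.
Qed.

(** Eight entries of the table that already separate the types of the list. *)
Definition signature (j : nat) (s : seq (nat * nat)) : seq nat :=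
  [:: string_rank s 1 1; string_rank s 1 2; string_rank s 2 1;
      string_rank s 2 2; string_rank s 3 1; string_rank s (j - 2) 1;
      string_rank s (j - 1) 0; string_rank s j 0].

(** The signatures do not depend on [j], so that their distinctness is a
    computation at j = 6. *)
Lemma signature_jdt j : 5 < j ->
  [seq signature j (jdt_seq j i) | i <- index_iota 1 27] =
  [seq signature 6 (jdt_seq 6 i) | i <- index_iota 1 27].
Proof.
move=> j5; apply/eq_in_map => n; rewrite mem_index_iota => n_in.
rewrite /signature !string_rank_jdt; try lia.
do 27?[case: n n_in => [|n] n_in]; try (by exfalso; lia);
 congr [:: _; _; _; _; _; _; _; _]; rewrite /column_profile /=; splitif; lia.
Qed.

Lemma uniq_by_invariant (T S : eqType) (f : nat -> T) (g : nat -> S) (L : seq nat) :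
  (forall m n, f m = f n -> g m = g n) -> uniq [seq g i | i <- L] -> uniq [seq f i | i <- L].
Proof.
move=> fg; elim: L => //= m L IH /andP[m_notin /IH ->]; rewrite andbT.
apply: contra m_notin => /mapP[n nL fmn]; apply/mapP; exists n => //; exact: fg.
Qed.

Lemma string_rank_jdt_eq j m n i d : jdt j m = jdt j n ->
  string_rank (jdt_seq j m) i d = string_rank (jdt_seq j n) i d.
Proof. by move/eq_seq_msetP/permP; apply. Qed.

Lemma jdt_uniq j : 5 < j -> uniq [seq jdt j i | i <- index_iota 1 27].
Proof.
move=> j5; apply: (@uniq_by_invariant _ _ _ (fun i => signature j (jdt_seq j i))).
  by move=> m n e; rewrite /signature !(string_rank_jdt_eq j m n).
by rewrite signature_jdt.
Qed.

Lemma jdt_uniq5 :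
  uniq [seq jdt 5 i | i <- [seq i <- index_iota 1 27 | i \notin [:: 6; 10; 18; 23]]].
Proof.
apply: (@uniq_by_invariant _ _ _ (fun i => signature 5 (jdt_seq 5 i))) => //.
by move=> m n e; rewrite /signature !(string_rank_jdt_eq 5 m n).
Qed.

Lemma jdt_uniq4 : uniq [seq jdt 4 i | i <- short_types].
Proof.
apply: (@uniq_by_invariant _ _ _ (fun i => signature 4 (jdt_seq 4 i))) => //.
by move=> m n e; rewrite /signature !(string_rank_jdt_eq 4 m n).
Qed.

Lemma jdt_coincide5 : [/\ jdt 5 4 = jdt 5 6, jdt 5 8 = jdt 5 10,
  jdt 5 16 = jdt 5 18 & jdt 5 21 = jdt 5 23].
Proof. by split; apply/eq_seq_msetP. Qed.

Lemma jdt_coincide4 : jdt 4 3 = jdt 4 5.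
Proof. exact/eq_seq_msetP. Qed.

Local Open Scope ring_scope.
Local Open Scope quotient_scope.

(** * Ranks in a graded algebra generated by three linear forms *)

Section Graded.
Variables (K : fieldType) (A : falgType K).
Hypothesis mulC : forall a b : A, a * b = b * a.
Variables (j : nat) (W : nat -> {vspace A}) (l y z : A).
Hypotheses (W0 : 1 \in W 0) (lW : l \in W 1).
Hypothesis W1 : W 1 = (<[l]> + <[y]> + <[z]>)%VS.
Hypothesis WS : forall d, W d.+1 = (W d * W 1)%VS.

Lemma comm_mulAC (a b c : A) : a * b * c = a * c * b.
Proof. by rewrite -mulrA (mulC b) mulrA. Qed.

Lemma prodvC (U V : {vspace A}) : (U * V = V * U)%VS.
Proof.
by apply/eqP; rewrite eqEsubv; apply/andP; split; apply/prodvP => u v Uu Vv;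
  rewrite mulC memv_mul.
Qed.

Definition limage (i d : nat) : {vspace A} := (W d * <[l ^+ i]>)%VS.

Lemma limage0 d : limage 0 d = W d.
Proof. by rewrite /limage expr0 prodv1. Qed.

Lemma limageSl i d : limage i.+1 d = (limage i d * <[l]>)%VS.
Proof. by rewrite /limage -prodvA prodv_line exprSr. Qed.

Lemma limageSr i d : limage i d.+1 = (limage i.+1 d + limage i d * <[y]> + limage i d * <[z]>)%VS.
Proof.
rewrite limageSl -!prodvDr -W1 /limage WS -!prodvA; congr (_ * _)%VS.
exact: prodvC.
Qed.

Definition yz_gen (i d a : nat) : A := l ^+ i * (y ^+ a * z ^+ (d - a)).

(** The flag that leads from l^(i+1) W_(d-1) to l^i W_d by adding the monomials
    l^i y^a z^(d-a) in increasing order of a.  Its jumps are the monomials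
    outside the ideal of leading terms, in Macaulay's argument. *)
Definition flag (i d a : nat) : {vspace A} :=
  ((if d is d'.+1 then limage i.+1 d' else 0) + <<[seq yz_gen i d b | b <- iota 0 a]>>)%VS.

Definition jump (i d a : nat) : bool := yz_gen i d a \notin flag i d a.

Lemma flagS i d a : flag i d a.+1 = (flag i d a + <[yz_gen i d a]>)%VS.
Proof. by rewrite /flag -[a.+1]addn1 iotaD map_cat span_cat addvA span_seq1. Qed.

Lemma dim_addv_line (U : {vspace A}) v : \dim (U + <[v]>) = (\dim U + (v \notin U))%N.
Proof.
case: (boolP (v \in U)) => [Uv|nUv] /=.
  by rewrite addn0 (addv_idPl _).
have v0 : v != 0 by apply: contraNneq nUv => ->; exact: mem0v.
rewrite dimv_disjoint_sum ?dim_vline ?v0 //.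
apply/eqP; rewrite -subv0; apply/subvP => u; rewrite memv_cap => /andP[Uu].
case/vlineP => c uE; rewrite memv0; apply: contraNT nUv => u0.
have c0 : c != 0 by apply: contraNneq u0; rewrite uE => ->; rewrite scale0r.
by rewrite -[v](scalerK c0) -uE memvZ.
Qed.

Lemma dim_flag i d a : \dim (flag i d a) =
  (\dim (if d is d'.+1 then limage i.+1 d' else 0%VS) + count (jump i d) (iota 0 a))%N.
Proof.
elim: a => [|a IH]; first by rewrite /flag span_nil addv0 addn0.
by rewrite flagS dim_addv_line IH -[a.+1]addn1 iotaD count_cat /= addn0 addnA.
Qed.

Lemma yz_gen_y i d a : yz_gen i d a * y = yz_gen i d.+1 a.+1.
Proof. by rewrite /yz_gen subSS -!mulrA (mulC _ y) (mulrA _ y) -exprSr. Qed.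

Lemma yz_gen_z i d a : (a <= d)%N -> yz_gen i d a * z = yz_gen i d.+1 a.
Proof. by move=> ad; rewrite /yz_gen subSn // exprSr !mulrA. Qed.

Lemma flag_sub i d a : (limage i.+1 d <= flag i d.+1 a)%VS.
Proof. exact: addvSl. Qed.

Lemma yz_gen_flag i d a b : (b < a)%N -> yz_gen i d b \in flag i d a.
Proof.
move=> ba; apply: (subvP (addvSr _ _)); apply: memv_span; apply: map_f.
by rewrite mem_iota.
Qed.

Lemma limage_mulr i d v : v \in W 1 -> (limage i d * <[v]> <= limage i d.+1)%VS.
Proof.
move=> v1; rewrite /limage -prodvA (prodvC _ <[v]>) prodvA; apply: prodvSl.
by rewrite WS; apply: prodvSr; rewrite -memvE.
Qed.

(** Multiplication by [v] carries one flag into the other; a monomial that is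
    redundant stays so after multiplication. *)
Lemma jump_mul i d a b v : (forall c, (c < a)%N -> yz_gen i d c * v \in flag i d.+1 b) ->
  yz_gen i d a * v = yz_gen i d.+1 b -> v \in W 1 -> jump i d.+1 b -> jump i d a.
Proof.
move=> gv gE v1; apply: contra => ga; rewrite -gE.
suff: (flag i d a * <[v]> <= flag i d.+1 b)%VS.
  by move/subvP; apply; apply: memv_mul ga (memv_line v).
rewrite {1}/flag prodvDl subv_add; apply/andP; split; last first.
  rewrite -limg_amulr limg_span; apply/span_subvP => u /mapP[w].
  by case/mapP => c; rewrite mem_iota => /andP[_ ca] -> ->; rewrite lfunE /= gv.
apply: subv_trans (flag_sub i d b); case: d {gv gE ga} => [|d].
  by rewrite prod0v sub0v.
exact: limage_mulr.
Qed.

Lemma yW : y \in W 1.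
Proof. by rewrite W1; apply: (subvP (addvSl _ _)); apply: (subvP (addvSr _ _)); apply: memv_line. Qed.
Lemma zW : z \in W 1.
Proof. by rewrite W1; apply: (subvP (addvSr _ _)); apply: memv_line. Qed.

Lemma jump_y i d a : jump i d.+1 a.+1 -> jump i d a.
Proof.
by apply: jump_mul yW => [c ca|]; rewrite yz_gen_y // yz_gen_flag.
Qed.

Lemma jump_z i d a : (a <= d)%N -> jump i d.+1 a -> jump i d a.
Proof.
move=> ad; apply: jump_mul zW => [c ca|]; rewrite yz_gen_z //; last by lia.
exact: yz_gen_flag.
Qed.

Hypothesis W0E : W 0 = <[1]>%VS.

(** W_(d+1) is generated by l, y and z from W_d, so by induction the flag ends at
    the whole of l^i W_d. *)
Lemma flag_full i d : flag i d d.+1 = limage i d.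
Proof.
elim: d => [|d IH].
  by rewrite /flag /= add0v span_seq1 /yz_gen !expr0 !mulr1 /limage W0E prod1v.
apply/eqP; rewrite eqEsubv; apply/andP; split.
  rewrite subv_add limageSr -addvA addvSl andTb; apply/span_subvP => u /mapP[a].
  rewrite mem_iota => /andP[_ ad] ->; rewrite addvA -limageSr.
  have g0 : yz_gen i d 0 \in limage i d by rewrite -IH yz_gen_flag.
  case: a ad => [|a] ad.
    rewrite -yz_gen_z //; apply: (subvP (limage_mulr i d _ zW)).
    by apply: memv_mul => //; exact: memv_line.
  rewrite -yz_gen_y; apply: (subvP (limage_mulr i d _ yW)).
  by apply: memv_mul; rewrite ?memv_line // -IH yz_gen_flag.
rewrite limageSr -addvA subv_add flag_sub /= subv_add -IH; apply/andP; split.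
  rewrite {1}/flag prodvDl subv_add; apply/andP; split.
    apply: subv_trans (flag_sub i d _); case: d {IH} => [|d]; last exact: limage_mulr yW.
    by rewrite prod0v sub0v.
  rewrite -limg_amulr limg_span; apply/span_subvP => u /mapP[w].
  case/mapP => c; rewrite mem_iota => /andP[_ ca] -> ->; rewrite lfunE /= yz_gen_y.
  exact: yz_gen_flag.
rewrite {1}/flag prodvDl subv_add; apply/andP; split.
  apply: subv_trans (flag_sub i d _); case: d {IH} => [|d]; last exact: limage_mulr zW.
  by rewrite prod0v sub0v.
rewrite -limg_amulr limg_span; apply/span_subvP => u /mapP[w].
case/mapP => c; rewrite mem_iota => /andP[_ ca] -> ->; rewrite lfunE /= yz_gen_z; last by lia.
by apply: yz_gen_flag; lia.
Qed.

Lemma dim_limage i d : \dim (limage i d.+1) = (\dim (limage i.+1 d) + count (jump i d.+1) (iota 0 d.+2))%N.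
Proof. by rewrite -flag_full dim_flag. Qed.

Lemma count_iota_le (p q : pred nat) a m :
  (forall b, (a <= b < a + m)%N -> p b -> q b) ->
  (count p (iota a m) <= count q (iota a m))%N.
Proof.
elim: m a => //= m IH a pq; apply: leq_add; last by apply: IH => b ?; apply: pq; lia.
by case: (boolP (p a)) => // pa; rewrite pq //; lia.
Qed.

Lemma count_iota_shift (p q : pred nat) a m : (forall b, p b.+1 -> q b) ->
  (count p (iota a.+1 m) <= count q (iota a m))%N.
Proof. by move=> pq; rewrite -[a.+1]add1n iotaDl count_map; apply: sub_count. Qed.

(** If a monomial y^a z^(d+1-a) is not a jump, then neither is z times it.  The
    jumps of degree d + 2 before that place inject into those of degree d + 1 by
    division by z, and the jumps after it by division by y. *)
Lemma limage_growth i d : (\dim (limage i d.+1) <= \dim (limage i.+1 d) + d.+1 ->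
  \dim (limage i d.+2) + \dim (limage i.+1 d) <= \dim (limage i d.+1) + \dim (limage i.+1 d.+1))%N.
Proof.
rewrite !(dim_limage i) leq_add2l => cd.
suff : (count (jump i d.+2) (iota 0 d.+3) <= count (jump i d.+1) (iota 0 d.+2))%N by lia.
have [a ad ja] : exists2 a, (a < d.+2)%N & ~~ jump i d.+1 a.
  have : ~~ all (jump i d.+1) (iota 0 d.+2).
    by rewrite all_count size_iota; lia.
  by rewrite -has_predC => /hasP[a]; rewrite mem_iota => /andP[_ ?] ?; exists a.
have -> : iota 0 d.+3 = iota 0 a ++ iota a (d.+2 - a).+1.
  by rewrite -{2}[a]add0n -iotaD; congr iota; lia.
have -> : iota 0 d.+2 = iota 0 a ++ iota a (d.+2 - a).
  by rewrite -{2}[a]add0n -iotaD; congr iota; lia.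
rewrite !count_cat /=.
have -> : jump i d.+2 a = false by apply: contraNF ja; apply: jump_z; lia.
rewrite add0n; apply: leq_add.
  by apply: count_iota_le => b ?; apply: jump_z; lia.
by apply: count_iota_shift => b; apply: jump_y.
Qed.

Lemma limage_zero i d : \dim (limage i d) = 0%N -> \dim (limage i d.+1) = 0%N.
Proof.
move/eqP; rewrite dimv_eq0 => /eqP z0.
suff -> : limage i d.+1 = 0%VS by rewrite dimv0.
by rewrite limageSr limageSl z0 !prod0v !addv0.
Qed.

Hypothesis Wout : forall d, (j < d)%N -> W d = 0%VS.
Hypothesis Wdir : forall d e a, a \in W d -> a \in W e -> d != e -> a = 0.
Hypothesis Wj : \dim (W j) = 1%N.
Hypothesis socW : forall a, (forall g, g \in W 1 -> g * a = 0) -> a \in W j.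

Lemma WM d e : (W d * W e)%VS = W (d + e).
Proof.
elim: e => [|e IH]; first by rewrite addn0 W0E prodv1.
by rewrite WS prodvA IH -WS addnS.
Qed.

Lemma W_pow i : l ^+ i \in W i.
Proof.
elim: i => [|i IH]; first by rewrite expr0.
by rewrite exprSr WS memv_mul.
Qed.

Lemma limage_sub i d : (limage i d <= W (i + d))%VS.
Proof. by rewrite addnC -WM; apply: prodvSr; rewrite -memvE W_pow. Qed.

Lemma limage_out i d : (j < i + d)%N -> \dim (limage i d) = 0%N.
Proof.
move=> out; apply/eqP; rewrite -leqn0 (leq_trans (dimvS (limage_sub i d))) //.
by rewrite Wout ?dimv0.
Qed.

(** Outside the top degree no nonzero element is killed by W_1, so one can climb
    degree by degree to the socle. *)
Lemma perfect_pairing m a : (m <= j)%N -> a \in W m -> a != 0 ->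
  exists2 b, b \in W (j - m) & a * b != 0.
Proof.
move=> mj; have [n En] : exists n, n = (j - m)%N by exists (j - m)%N.
rewrite -En; elim: n m a En mj => [|n IH] m a En mj Wa a0.
  by exists 1; rewrite ?W0 ?mulr1.
have : ~~ [forall i : 'I_(\dim (W 1)), a * (vbasis (W 1))`_i == 0].
  apply/negP => /forallP z0; case/negP: a0; apply/eqP.
  apply: (Wdir m j) => //; last by lia.
  apply: socW => g gW.
  rewrite mulC (coord_vbasis gW) mulr_sumr big1 // => i _.
  by rewrite -scalerAr (eqP (z0 i)) scaler0.
rewrite negb_forall => /existsP[i gi].
have g1 : (vbasis (W 1))`_i \in W 1 by rewrite vbasis_mem ?mem_nth ?size_tuple.
have [|||b Wb b0] := IH m.+1 _ _ _ _ gi; try lia.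
  by rewrite (WS m) memv_mul.
by exists ((vbasis (W 1))`_i * b); rewrite ?mulrA // -[n.+1]add1n -WM memv_mul.
Qed.

(** Both spaces l^i W_d and l^i W_e carry the pairing (l^i u, l^i v) |-> l^i u v
    with values in the line W_j; it is nondegenerate on the left by
    [perfect_pairing]. *)
Lemma limage_sym_le i d e : (i + d + e = j)%N -> (\dim (limage i d) <= \dim (limage i e))%N.
Proof.
move=> ide; pose w := (vbasis (W j))`_0.
have wE : W j = <[w]>%VS.
  rewrite -[LHS](span_basis (vbasisP (W j))) /w.
  have : size (tval (vbasis (W j))) = 1%N by rewrite size_tuple Wj.
  by case: (tval (vbasis (W j))) => [|w' []] //= _; rewrite span_seq1.
pose m := \dim (limage i e).
have bP t : exists2 b, b \in W e & (vbasis (limage i e))`_t = b * l ^+ i.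
  have : (vbasis (limage i e))`_t \in limage i e.
    have [lt|ge] := ltnP t m; first by rewrite vbasis_mem ?mem_nth ?size_tuple.
    by rewrite nth_default ?mem0v // size_tuple.
  by case/memv_cosetP => b ? ?; exists b.
have [b bW bE] : exists2 b : nat -> A, (forall t, b t \in W e) &
    forall t, (vbasis (limage i e))`_t = b t * l ^+ i.
  have f t : {x : A | (x \in W e) && ((vbasis (limage i e))`_t == x * l ^+ i)}.
    by apply: sigW; case: (bP t) => x xW xE; exists x; rewrite xW xE eqxx.
  by exists (fun t => sval (f t)) => t; case: (f t) => x /= /andP[? /eqP].
pose ph (a : A) := coord [tuple w] ord0 a.
have phP a : a \in W j -> ph a = 0 -> a = 0.
  rewrite wE -span_seq1 => /(coord_span (X := [tuple w])) {2}->.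
  by rewrite big_ord1 -/(ph a) => ->; rewrite scale0r.
pose g (a : A) := \row_(t < m) ph (a * b t).
have gl : linear g.
  move=> k u v; apply/rowP => t; rewrite !mxE mulrDl -scalerAl.
  by rewrite /ph linearP.
pose gL : {linear A -> 'rV[K]_m} := HB.pack g (GRing.isLinear.Build _ _ _ _ _ gl).
pose f := linfun gL.
have <- := limg_ker_dim f (limage i d).
have -> : (limage i d :&: lker f = 0)%VS.
  apply/eqP; rewrite -subv0; apply/subvP => u; rewrite memv_cap memv0 => /andP[uc].
  rewrite memv_ker lfunE /= => /eqP /rowP fu; apply/eqP.
  have [u' Wu' uE] := memv_cosetP uc.
  have uW : u \in W (i + d) by apply: (subvP (limage_sub i d)).
  apply/eqP; apply: contraT => u0.
  have [|c] := perfect_pairing (i + d) u _ uW u0; first by lia.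
  rewrite (_ : j - (i + d) = e)%N; last by lia.
  move=> cW /negP[]; apply/eqP.
  have : c * l ^+ i \in limage i e by rewrite memv_mul ?memv_line.
  move/coord_vbasis => cE.
  rewrite uE -mulrA (mulC _ c) cE mulr_sumr big1 // => t _.
  rewrite -scalerAr bE (mulC (b t)) mulrA -uE (phP (u * b t)) ?scaler0 //.
    by rewrite -ide -WM memv_mul.
  by have := fu t; rewrite !mxE.
rewrite dimv0 add0n; apply: leq_trans (dimvS (subvf _)) _.
by rewrite dimvf /dim /= mul1n.
Qed.

Lemma limage_sym i d : (i + d <= j)%N -> \dim (limage i d) = \dim (limage i (j - i - d)).
Proof. by move=> ij; apply/eqP; rewrite eqn_leq !limage_sym_le //; lia. Qed.

Variable s : seq (A * (nat * nat)).
Hypothesis sP : forall v p nu, (v, (p, nu)) \in s ->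
  [/\ (0 < p)%N, v \in W nu & l ^+ p * v = 0].
Hypothesis sB : basis_of fullv
  (flatten [seq [seq l ^+ i * x.1 | i <- iota 0 x.2.1] | x <- s]).
Variable P : nat -> 'End(A).
Hypothesis PW : forall d e a, a \in W e -> P d a = if d == e then a else 0.

(** The elements l^(d-nu+i) v, for the generators v of the strings alive from
    degree [d] to degree [d + i], form a basis of l^i W_d.  The projections [P]
    on the graded pieces give the generation: they reduce a decomposition in the
    basis of strings to its terms of degree [d]. *)
Lemma dim_limage_string_rank i d : \dim (limage i d) = string_rank [seq x.2 | x <- s] i d.
Proof.
pose inE (x : A * (nat * nat)) := (x.2.2 <= d)%N && (d + i < x.2.2 + x.2.1)%N.
pose E := [seq l ^+ (d - x.2.2 + i) * x.1 | x <- [seq x <- s | inE x]].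
have -> : string_rank [seq x.2 | x <- s] i d = size E.
  by rewrite size_map size_filter /string_rank count_map.
have freeE : free E.
  have subE : subseq E (flatten [seq [seq l ^+ i * x.1 | i <- iota 0 x.2.1] | x <- s]).
    rewrite /E; elim: (s) => //= x s' IH.
    case: ifP => [/andP[x1 x2]|_]; last first.
      by apply: subseq_trans IH _; apply: suffix_subseq.
    rewrite map_cons -cat1s; apply: cat_subseq IH; rewrite sub1seq.
    by apply: map_f; rewrite mem_iota; lia.
  have [s3 /perm_free e] := perm_to_subseq subE.
  by have := basis_free sB; rewrite e; apply: catl_free.
suff -> : limage i d = <<E>>%VS by apply/eqP.
apply/eqP; rewrite eqEsubv; apply/andP; split; last first.
  apply/span_subvP => u /mapP[[v [p nu]]]; rewrite mem_filter => /andP[/andP[/= h1 h2] /sP[p0 vW _]] ->.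
  rewrite exprD comm_mulAC memv_mul ?memv_line // -(subnK h1) -WM memv_mul // addnK.
  exact: W_pow.
have {1}-> : limage i d = (amulr (l ^+ i) @: W d)%VS by rewrite limg_amulr.
pose B := flatten [seq [seq l ^+ i * x.1 | i <- iota 0 x.2.1] | x <- s].
have WP : (W d <= P d @: <<B>>)%VS.
  apply/subvP => a aW; rewrite /B (span_basis sB).
  by apply/memv_imgP; exists a; rewrite ?memvf // (PW d d) ?eqxx.
apply: subv_trans (limgS _ WP) _; rewrite !limg_span; apply/span_subvP => u.
case/mapP => u1 /mapP[u2 /flatten_mapP[[v [p nu]] vs /mapP[k]]].
rewrite mem_iota /= add0n => kp -> -> ->.
have [p0 vW lv] := sP _ _ _ vs.
rewrite (PW d (k + nu)); last by rewrite -WM memv_mul ?W_pow.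
case: eqP => [dE|_]; last by rewrite linear0 mem0v.
rewrite lfunE /= comm_mulAC -exprD.
have [lt|ge] := ltnP (d + i) (nu + p).
  apply: memv_span; apply/mapP; exists (v, (p, nu)).
    by rewrite mem_filter vs /inE /= lt andbT; lia.
  by congr (l ^+ _ * _) => /=; lia.
by rewrite -(subnK (_ : p <= k + i)%N) ?exprD -?mulrA ?lv ?mulr0 ?mem0v //; lia.
Qed.

Hypothesis hilb : forall d, \dim (W d) = nth 0%N (T4 (j - 3)) d.
Hypothesis l0 : l != 0.

Lemma gor_ranks_string_rank : gor_ranks j (string_rank [seq x.2 | x <- s]).
Proof.
have E i d := dim_limage_string_rank i d.
split=> [d||i d ij|i d ij|i d|i d|i d|i d].
- by rewrite -E limage0 hilb.
- by rewrite -E /limage W0E prod1v dim_vline expr1 l0.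
- by rewrite -E limage_out.
- by rewrite -!E limage_sym.
- by rewrite -!E; apply: limage_zero.
- by rewrite -!E; apply: limage_growth.
- exact: string_rank_mono.
- exact: string_rank_conv.
Qed.

End Graded.

(** * Finite-dimensional quotients of a polynomial ring *)

Section FinDim.
Variables (K : fieldType) (V : lmodType K) (s : seq V).
Hypothesis hs : is_basis (fun _ => True) s.

Lemma coord_ex v : exists c : {ffun 'I_(size s) -> K}, v == \sum_(i < size s) c i *: s`_i.
Proof. by have [c [/eqP ? _]] := hs.2 v I; exists c. Qed.

Definition coordf v := xchoose (coord_ex v).

Lemma coordfE v : v = \sum_(i < size s) coordf v i *: s`_i.
Proof. exact/eqP/(xchooseP (coord_ex v)). Qed.

Lemma coordf_unique (c : {ffun 'I_(size s) -> K}) :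
  coordf (\sum_(i < size s) c i *: s`_i) = c.
Proof.
set v := \sum_(i < _) _; have [c' [_ u]] := hs.2 v I.
by rewrite -(u _ (coordfE v)) (u c).
Qed.

Lemma findim_axiom : Vector.axiom (size s) V.
Proof.
exists (fun v => \row_i coordf v i).
  move=> a u v; apply/rowP => i; rewrite !mxE.
  have -> : a *: u + v =
     \sum_(i < size s) [ffun i => a * coordf u i + coordf v i] i *: s`_i.
    rewrite {1}(coordfE u) {1}(coordfE v) scaler_sumr -big_split /=.
    by apply: eq_bigr => k _; rewrite ffunE scalerDl scalerA.
  by rewrite coordf_unique ffunE.
exists (fun r : 'rV_(size s) => \sum_(i < size s) r 0 i *: s`_i) => [v|r].
  by rewrite {2}(coordfE v); apply: eq_bigr => i _; rewrite mxE.
apply/rowP => i; rewrite mxE.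
have -> : \sum_(k < size s) r 0 k *: s`_k =
  \sum_(k < size s) [ffun k => r 0 k] k *: s`_k.
  by apply: eq_bigr => k _; rewrite ffunE.
by rewrite coordf_unique ffunE.
Qed.
End FinDim.

Lemma is_basis_basis_of (K : fieldType) (V : vectType K) (W : V -> Prop)
    (U : {vspace V}) (s : seq V) :
  (forall v, W v <-> v \in U) -> is_basis W s -> basis_of U s.
Proof.
move=> WU [sW su]; apply/andP; split.
  rewrite eqEsubv; apply/andP; split.
    apply/span_subvP => v /(nthP 0)[i si <-]; apply/WU.
    exact: (sW (Ordinal si)).
  apply/subvP => v /WU /su[c [-> _]]; apply: memv_suml => i _.
  by apply/memvZ/memv_span/mem_nth.
change (free (in_tuple s)); apply/freeP => k k0 i.
have W0 : W 0 by apply/WU; exact: mem0v.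
have [c [_ u]] := su 0 W0.
have e1 : c = [ffun i => k i].
  by apply: u; rewrite -[LHS]k0; apply: eq_bigr => m _; rewrite ffunE.
have e2 : c = [ffun => 0].
  by apply: u; rewrite big1 // => m _; rewrite ffunE scale0r.
move: e1; rewrite e2.
by move/ffunP/(_ i); rewrite !ffunE => <-.
Qed.

Section Quot.
Variables (K : fieldType) (n : nat) (I : idealr {mpoly K[n]}).
Fact quot_scaleAr (c : K) (a b : {ideal_quot I}) : c *: (a * b) = a * (c *: b).
Proof. by rewrite (mulrC a b) scalerAl mulrC. Qed.
HB.instance Definition _ := GRing.Lalgebra_isAlgebra.Build K {ideal_quot I} quot_scaleAr.

Lemma pi_scale (c : K) p : \pi_{ideal_quot I} (c *: p) = c *: \pi_{ideal_quot I} p.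
Proof. by rewrite -mul_mpolyC rmorphM. Qed.

Lemma pi_eq0 p : (\pi_{ideal_quot I} p = 0) <-> (p \in I).
Proof.
by rewrite -[p in p \in I]subr0 Quotient.idealrBE rmorph0; split=> [/eqP|/eqP].
Qed.

Variable s : seq {ideal_quot I}.
Hypothesis hs : is_basis (fun _ => True) s.
(** The quotient algebra with the vector space structure given by a finite basis;
    the basis is a parameter of the type, so that subspaces and dimensions make
    sense in it. *)
Definition fin_quot of is_basis (fun _ => True) s : Type := {ideal_quot I}.
Local Notation A := (fin_quot hs).
HB.instance Definition _ := GRing.Algebra.copy A {ideal_quot I}.
HB.instance Definition _ := Lmodule_hasFinDim.Build K A (findim_axiom K {ideal_quot I} s hs).
HB.instance Definition _ := Algebra_isFalgebra.Build K A.
End Quot.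

Section Pieces.
Variables (K : fieldType) (n : nat) (I : idealr {mpoly K[n]}).
Local Notation A := {ideal_quot I}.

Lemma graded_pieceM d e (a b : A) :
  graded_piece d a -> graded_piece e b -> graded_piece (d + e) (a * b).
Proof.
by case=> p pd -> [q qe ->]; exists (p * q); rewrite ?rmorphM ?dhomogM.
Qed.

Lemma graded_piece_sum d (T : Type) (r : seq T) (F : T -> A) :
  (forall i, graded_piece d (F i)) -> graded_piece d (\sum_(i <- r) F i).
Proof.
move=> gF; elim/big_rec: _ => [|i x _ [q qd ->]].
  by exists 0; rewrite ?rmorph0 ?dhomog0.
by case: (gF i) => p pd ->; exists (p + q); rewrite ?rmorphD ?dhomogD.
Qed.

Lemma graded_pieceZ d c (a : A) : graded_piece d a -> graded_piece d (c *: a).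
Proof. by case=> p pd ->; exists (c *: p); rewrite ?pi_scale ?dhomogZ. Qed.

(** The component of degree [d]; it is well defined on classes because the ideal
    is homogeneous. *)
Definition graded_proj (d : nat) (a : A) : A := \pi_A (pihomog mdeg d (repr a)).

Hypothesis homI : homogeneous_ideal I.

Lemma graded_proj_pi d p : graded_proj d (\pi_A p) = \pi_A (pihomog mdeg d p).
Proof.
apply/eqP; rewrite -subr_eq0 -rmorphB -raddfB /=; apply/eqP/pi_eq0/homI.
by rewrite Quotient.idealrBE reprK.
Qed.

Lemma graded_proj_linear d : linear (graded_proj d).
Proof.
move=> c a b; rewrite -[a]reprK -[b]reprK -pi_scale -rmorphD !graded_proj_pi.
by rewrite linearD linearZ rmorphD /= -mul_mpolyC rmorphM.
Qed.

Lemma graded_proj_piece d e a : graded_piece e a -> graded_proj d a = if d == e then a else 0.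
Proof.
case=> p pe ->; rewrite graded_proj_pi; case: eqP => [->|/eqP de].
  by rewrite pihomog_dE.
by rewrite (pihomog_ne0 _ pe) ?rmorph0 // eq_sym.
Qed.
End Pieces.

(** * The ranks of an occurring type *)

Lemma complete_line_of_dim3 (K : fieldType) (V : vectType K) (U : {vspace V}) (l : V) :
  \dim U = 3 -> l \in U -> l != 0 -> exists y z, U = (<[l]> + <[y]> + <[z]>)%VS.
Proof.
move=> U3 lU l0.
have E : (<[l]> + (U :\: <[l]>) = U)%VS.
  by rewrite addvC addv_diff; apply/addv_idPl; rewrite -memvE.
have d2 : \dim (U :\: <[l]>) = 2.
  have := dimv_cap_compl U <[l]>; rewrite (capv_idPr _) -?memvE //.
  by rewrite dim_vline l0 U3 => -[].
have := span_basis (vbasisP (U :\: <[l]>)).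
have : size (tval (vbasis (U :\: <[l]>))) = 2 by rewrite size_tuple d2.
case: (tval (vbasis _)) => [|y [|z []]] //= _ e.
by exists y, z; rewrite -{1}E -e span_cons span_seq1 addvA.
Qed.

Section OccurringRanks.
Variables (K : fieldType) (k j : nat) (I : idealr {mpoly K[3]}).
Local Notation A0 := {ideal_quot I}.
Variables (l : A0) (s : seq (A0 * (nat * nat))).
Hypotheses (k0 : (0 < k)%N) (hj : j = (k + 3)%N).
Hypotheses (homI : homogeneous_ideal I) (gorI : gorenstein I).
Hypothesis hilbI : has_hilbert_function I (T4 k).
Hypotheses (l1 : graded_piece 1 l) (l0 : l != 0).
Hypothesis sP : forall v p nu, (v, (p, nu)) \in s ->
  [/\ (0 < p)%N, graded_piece nu v & l ^+ p * v = 0].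
Hypothesis sB : is_basis (fun _ : A0 => True)
   (flatten [seq string l x.1 x.2.1 | x <- s]).

Local Notation A := (fin_quot K 3 I _ sB).

Definition var_class (i : 'I_3) : A := \pi_A0 'X_i.
Definition V1 : {vspace A} := <<[seq var_class i | i <- enum 'I_3]>>%VS.
(** The graded pieces as vector subspaces: the powers of the space of linear
    forms.  They agree with [graded_piece] by [pieceE]. *)
Fixpoint piece (d : nat) : {vspace A} :=
  if d is d'.+1 then (piece d' * V1)%VS else 1%VS.

Lemma var_V1 i : var_class i \in V1.
Proof. by apply/memv_span/map_f; rewrite mem_enum. Qed.

Lemma monomial_piece (m : 'X_{1..3}) : (\pi_A0 'X_[m] : A) \in piece (mdeg m).
Proof.
have [d Ed] : exists d, d = mdeg m by exists (mdeg m).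
rewrite -Ed; elim: d m Ed => [|d IH] m /esym Em.
  move/eqP: Em; rewrite mdeg_eq0 => /eqP ->; rewrite mpolyX0 rmorph1; exact: memv_line.
have [i mi] : exists i, (0 < m i)%N.
  apply/existsP; apply: contraPT Em; rewrite negb_exists => /forallP z.
  rewrite mdegE big1 // => i _; have := z i; lia.
have [m' m'E] : exists m', m = (m' + U_(i))%MM.
  exists (m - U_(i))%MM.
  by apply/mnmP => t; rewrite mnmDE mnmBE mnm1E; case: eqP => [<-|]; lia.
move: Em; rewrite m'E mdegD mdeg1 addn1 => -[Em].
by rewrite mpolyXD rmorphM /=; apply: memv_mul (var_V1 i); apply: IH.
Qed.

Lemma piece_of d (a : A0) : graded_piece d a -> (a : A) \in piece d.
Proof.
case=> p pd ->; rewrite [p]mpolyE rmorph_sum big_seq /=.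
elim/big_rec: _ => [|m x mp xd]; first exact: mem0v.
apply: memvD xd; rewrite pi_scale; apply: memvZ.
by rewrite -(dhomog_mf pd mp); apply: monomial_piece.
Qed.

Lemma span_graded d (X : seq A) (a : A) : a \in <<X>>%VS ->
  (forall x, x \in X -> graded_piece d (x : A0)) -> graded_piece d (a : A0).
Proof.
move=> /(coord_span (X := in_tuple X)) -> gX; apply: graded_piece_sum => i.
by apply: graded_pieceZ; apply: gX; rewrite mem_nth.
Qed.

Lemma of_piece d (a : A) : a \in piece d -> graded_piece d (a : A0).
Proof.
elim: d a => [|d IH] a.
  case/vlineP => c ->; apply: (graded_pieceZ K 3 I 0 c (1 : A0)).
  by exists 1; rewrite ?rmorph1 ?dhomog1.
rewrite /= unlock => /span_graded; apply => x /allpairsP[[u v] /= [uV vV ->]].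
rewrite -[d.+1]addn1; apply: (graded_pieceM K 3 I d 1 (u : A0) (v : A0)).
  by apply: IH; apply: vbasis_mem.
apply: (span_graded 1 [seq var_class i | i <- enum 'I_3]); first exact: vbasis_mem.
move=> _ /mapP[i _ ->]; exists 'X_i => //.
by rewrite dhomogX /= mdeg1.
Qed.

Lemma pieceE d (a : A) : graded_piece d (a : A0) <-> a \in piece d.
Proof. by split; [apply: piece_of|apply: of_piece]. Qed.

Lemma dim_piece d : \dim (piece d) = nth 0%N (T4 k) d.
Proof.
have [b sz bb] := hilbI d.
have /andP[/eqP <-] := is_basis_basis_of K A _ (piece d) b (pieceE d) bb.
by rewrite /free sz => /eqP.
Qed.

Lemma quot_mulC (a b : A) : a * b = b * a. Proof. exact: (mulrC (a : A0)). Qed.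

Lemma piece1 : piece 1 = V1. Proof. exact: prod1v. Qed.

Lemma pieceS d : piece d.+1 = (piece d * piece 1)%VS.
Proof. by rewrite piece1. Qed.

Definition graded_projL (d : nat) : {linear A -> A} :=
  HB.pack (graded_proj K 3 I d : A -> A)
    (GRing.isLinear.Build K A A _ (graded_proj K 3 I d : A -> A) (graded_proj_linear K 3 I homI d)).

Lemma graded_projLP d e (a : A) : a \in piece e -> linfun (graded_projL d) a = if d == e then a else 0.
Proof.
by move=> /pieceE ae; rewrite lfunE /=; apply: graded_proj_piece.
Qed.

Lemma piece_direct d e (a : A) : a \in piece d -> a \in piece e -> d != e -> a = 0.
Proof.
move=> ad ae /negbTE de; have := graded_projLP d d a ad; rewrite eqxx => <-.
by rewrite (graded_projLP d e a ae) de.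
Qed.

Lemma nthT4_gt d : (j < d)%N -> nth 0%N (T4 k) d = 0%N.
Proof. by move=> jd; rewrite nth_default // /T4 !size_cat size_nseq /=; lia. Qed.

Lemma nthT4_j : nth 0%N (T4 k) j = 1%N.
Proof.
by rewrite /T4 hj addn3 /= nth_cat size_nseq ltnNge leqnSn /= subSnn.
Qed.

Lemma piece_out d : (j < d)%N -> piece d = 0%VS.
Proof. by move=> jd; apply/eqP; rewrite -dimv_eq0 dim_piece nthT4_gt. Qed.

Lemma socle_var (a : A0) : (forall i, var_class i * a = 0) -> socle a.
Proof.
move=> va _ [p p0 ->]; rewrite [p]mpolyE rmorph_sum /= mulr_suml big1_seq // => m.
rewrite andTb => mp.
have m0 : m != 0%MM by apply: contraTneq mp => ->; rewrite mcoeff_msupp p0 eqxx.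
have [i mi] : exists i, (0 < m i)%N.
  apply/existsP; apply: contraNT m0; rewrite negb_exists => /forallP z.
  by rewrite -mdeg_eq0 mdegE big1 // => i _; have := z i; lia.
have [m' ->] : exists m', m = (m' + U_(i))%MM.
  exists (m - U_(i))%MM.
  by apply/mnmP => t; rewrite mnmDE mnmBE mnm1E; case: eqP => [<-|]; lia.
rewrite pi_scale mpolyXD rmorphM /= -scalerAl -mulrA.
by have /= -> := va i; rewrite mulr0 scaler0.
Qed.

(** The socle is one-dimensional and contains the nonzero piece of degree [j],
    hence equals it. *)
Lemma socle_piece (a : A) : (forall g, g \in piece 1 -> g * a = 0) -> a \in piece j.
Proof.
move=> ga; have sa : socle (a : A0).
  by apply: socle_var => i; apply: ga; rewrite piece1 var_V1.
have [b szb [bS bE]] := gorI.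
case: b szb bS bE => [|b []] //= _ bS bE.
have line (c : A0) : socle c -> exists x, c = x *: b.
  by move=> /bE[f [-> _]]; rewrite big_ord1; exists (f ord0).
have [w wj w0] : exists2 w : A, w \in piece j & w != 0.
  have : piece j != 0%VS by rewrite -dimv_eq0 dim_piece nthT4_j.
  by exists (vpick (piece j)); rewrite ?memv_pick ?vpick0.
have sw : socle (w : A0).
  apply: socle_var => i; apply/eqP; rewrite -memv0 -(piece_out j.+1) //=.
  by rewrite mulrC memv_mul ?var_V1.
have [x ax] := line _ sa; have [u wu] := line _ sw.
have u0 : u != 0 by apply: contraNneq w0 => u0; rewrite wu u0 scale0r.
rewrite ax -[b](scalerK u0) -wu; apply: memvZ; exact: memvZ.
Qed.

Theorem gor_ranks_of_strings : gor_ranks j (string_rank [seq x.2 | x <- s]).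
Proof.
have V13 : \dim (piece 1) = 3 by rewrite dim_piece.
have [y [z yz]] := complete_line_of_dim3 K A (piece 1) l V13 (piece_of _ _ l1) l0.
apply: (gor_ranks_string_rank K A quot_mulC j piece l y z _ _ yz pieceS _ piece_out piece_direct _
   socle_piece s _ _ (fun d => linfun (graded_projL d)) graded_projLP) => //.
- exact: memv_line.
- exact: piece_of.
- by rewrite dim_piece nthT4_j.
- by move=> v p nu /sP[? ? ?]; split=> //; apply: piece_of.
- by apply: (is_basis_basis_of K A (fun _ => True) fullv _ _ sB) => v; rewrite memvf.
- by move=> d; rewrite dim_piece (_ : j - 3 = k)%N //; lia.
Qed.
End OccurringRanks.

(** * Bases from dual families *)

Lemma scalar_sum (K : fieldType) (A : lmodType K) (p : A -> K) : scalar p ->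
  forall (J : Type) (r : seq J) (c : J -> K) (v : J -> A),
  p (\sum_(i <- r) c i *: v i) = \sum_(i <- r) c i * p (v i).
Proof.
move=> pl J r c v.
have p0 : p 0 = 0 by have := pl (-1) 0 0; rewrite scaler0 addr0 mulN1r addNr.
elim/big_rec2: _ => [//|i y1 y2 _ <-]; exact: pl.
Qed.

(** The [e i] are combinations of the [u k] with matrix M; the pairings of the
    [u k] with the dual family give G with M G diagonal and invertible.  Since M
    has at least as many rows as columns, it is then invertible, which expresses
    the [u k] by the [e i]. *)
Lemma dual_span (K : fieldType) (A : lmodType K) (m n : nat) (u : 'I_m -> A)
    (e : 'I_n -> A) (pair : 'I_n -> A -> K) :
  (m <= n)%N ->
  (forall k, scalar (pair k)) ->
  (forall i k, (pair k (e i) != 0) = (i == k)) ->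
  (forall i, exists c : 'I_m -> K, e i = \sum_k c k *: u k) ->
  forall k, exists c : 'I_n -> K, u k = \sum_i c i *: e i.
Proof.
move=> mn lin_pair pairE eu.
have [M ME] : exists M : 'M[K]_(n, m), forall i, e i = \sum_k M i k *: u k.
  have [c cE] : exists c : {ffun 'I_n -> {ffun 'I_m -> K}}, forall i, e i = \sum_k c i k *: u k.
    have ex i : exists c : {ffun 'I_m -> K}, e i == \sum_k c k *: u k.
      have [c ->] := eu i; exists [ffun k => c k]; apply/eqP.
      by apply: eq_bigr => k _; rewrite ffunE.
    exists [ffun i => xchoose (ex i)] => i.
    by rewrite ffunE; exact: eqP (xchooseP (ex i)).
  by exists (\matrix_(i, k) c i k) => i; rewrite cE; apply: eq_bigr => k _; rewrite mxE.
pose G := \matrix_(k < m, i < n) pair i (u k).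
have pair_sum k := scalar_sum K A (pair k) (lin_pair k).
pose D := \row_(i < n) pair i (e i).
have MG : M *m G = diag_mx D.
  apply/matrixP => i k; rewrite !mxE.
  transitivity (pair k (e i)).
    by rewrite ME pair_sum; apply: eq_bigr => t _; rewrite mxE.
  have := pairE i k; case: (eqVneq i k) => [->|ik] /=.
    by [].
  by move/negbFE/eqP => ->.
have unitD : diag_mx D \in unitmx.
  rewrite unitmxE det_diag unitfE; apply/prodf_neq0 => i _; rewrite mxE.
  by rewrite pairE eqxx.
have rM : row_full M.
  rewrite /row_full eqn_leq rank_leq_col (leq_trans mn) //.
  have e1 : \rank (M *m G) = n by apply/eqP; rewrite MG -/(row_free _) row_free_unit.
  by have := mxrankM_maxl M G; rewrite e1.
move=> k; exists (fun i => pinvmx M k i).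
have : u k = \sum_t (pinvmx M *m M) k t *: u t.
  rewrite mulVpmx // (bigD1 k) //= mxE eqxx scale1r big1 ?addr0 // => t tk.
  by rewrite mxE eq_sym (negbTE tk) scale0r.
move=> {1}->; transitivity (\sum_t \sum_i (pinvmx M k i * M i t) *: u t).
  by apply: eq_bigr => t _; rewrite mxE scaler_suml.
rewrite exchange_big /=; apply: eq_bigr => i _.
by rewrite ME scaler_sumr; apply: eq_bigr => t _; rewrite scalerA.
Qed.

(** A family with a dual family is independent: pairing a relation with the dual
    of one member isolates its coefficient. *)
Lemma dual_basis (K : fieldType) (A : lmodType K) (W : A -> Prop) (T : eqType)
   (E : seq T) (f : T -> A) (pair : T -> A -> K) :
  uniq E -> (forall e, scalar (pair e)) ->
  (forall e e', e \in E -> e' \in E -> (pair e (f e') != 0) = (e == e')) ->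
  (forall e, e \in E -> W (f e)) ->
  (forall v, W v -> exists c : T -> K, v = \sum_(e <- E) c e *: f e) ->
  is_basis W [seq f e | e <- E].
Proof.
move=> uE lin pairE WE span.
case sE : E => [|e0 E']; first split=> [[]//|v /span[c]].
  rewrite sE big_nil => ->; exists [ffun => 0]; split; first by rewrite big_ord0.
  by move=> c' _; apply/ffunP => -[].
rewrite -sE; pose x i := nth e0 E i.
have szE : size [seq f e | e <- E] = size E by rewrite size_map.
have fx i : (i < size E)%N -> [seq f e | e <- E]`_i = f (x i).
  by move=> iE; rewrite (nth_map e0).
have xE i : (i < size E)%N -> x i \in E by move=> iE; apply: mem_nth.
have single (c : 'I_(size [seq f e | e <- E]) -> K) (i : 'I_(size [seq f e | e <- E])) :
    pair (x i) (\sum_(k < size [seq f e | e <- E]) c k *: [seq f e | e <- E]`_k) =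
    c i * pair (x i) (f (x i)).
  rewrite (scalar_sum _ _ _ (lin (x i))) (bigD1 i) //= fx -?szE // big1 ?addr0 //.
  move=> k ki; rewrite fx -?szE //.
  have iE : (i < size E)%N by rewrite -szE.
  have kE : (k < size E)%N by rewrite -szE.
  have := pairE (x i) (x k) (xE _ iE) (xE _ kE).
  rewrite nth_uniq // (_ : (i == k :> nat) = false); last by rewrite eq_sym; apply/negbTE.
  by move/negbFE/eqP ->; rewrite mulr0.
split=> [i|v Wv].
  by rewrite fx -?szE //; apply/WE/xE; rewrite -szE.
have [c vE] := span v Wv.
have vE1 : v = \sum_(i < size [seq f e | e <- E])
   [ffun i : 'I_(size [seq f e | e <- E]) => c (x i)] i *: [seq f e | e <- E]`_i.
  rewrite {1}vE (big_nth e0) big_mkord -szE; apply: eq_bigr => i _.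
  by rewrite ffunE fx // -szE.
exists [ffun i : 'I_(size [seq f e | e <- E]) => c (x i)]; split=> // c' vE'.
apply/ffunP => i.
have := single c' i; have := single [ffun i : 'I_(size [seq f e | e <- E]) => c (x i)] i.
rewrite -vE1 -vE' => -> /mulIf; apply.
by rewrite pairE ?eqxx ?xE -?szE.
Qed.

(** * The ideal apolar to a sum of monomials *)

Definition idx_y : 'I_3 := Ordinal (isT : 1 < 3)%N.
Definition idx_z : 'I_3 := Ordinal (isT : 2 < 3)%N.

(** The exponent of x^a y^b z^c. *)
Definition mnm3 (a b c : nat) : 'X_{1..3} := [multinom nth 0%N [:: a; b; c] i | i < 3].

Lemma mnm3_y a b c : mnm3 a b c idx_y = b. Proof. by rewrite mnmE. Qed.
Lemma mnm3_z a b c : mnm3 a b c idx_z = c. Proof. by rewrite mnmE. Qed.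

Lemma mdeg3 (m : 'X_{1..3}) : mdeg m = (m ord0 + m idx_y + m idx_z)%N.
Proof.
rewrite mdegE !big_ord_recl big_ord0 addn0 addnA.
by congr (_ + _ + _)%N; congr (m _); apply: val_inj.
Qed.

Lemma mdeg_mnm3 a b c : mdeg (mnm3 a b c) = (a + b + c)%N.
Proof. by rewrite mdeg3 !mnmE. Qed.

Lemma mnm3E (m : 'X_{1..3}) : m = mnm3 (m ord0) (m idx_y) (m idx_z).
Proof.
apply/mnmP => -[[|[|[|//]]] i3]; rewrite mnmE /=; congr (m _); exact: val_inj.
Qed.

Lemma mnm3M a b c a' b' c' :
  (mnm3 a b c + mnm3 a' b' c')%MM = mnm3 (a + a') (b + b') (c + c').
Proof. by apply/mnmP => -[[|[|[|//]]] i3]; rewrite mnmDE !mnmE. Qed.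

Section Functional.
Variables (K : fieldType) (j : nat) (F : nat -> nat -> bool).
Local Notation R := {mpoly K[3]}.

Definition form_coef (m : 'X_{1..3}) : K := if mdeg m == j then (F (m idx_y) (m idx_z))%:R else 0.

(** The functional p |-> <F, p> dual to the form F of degree [j] whose monomials
    are the x^(j-b-c) y^b z^c with [F b c]. *)
Definition dual_form (p : R) : K := \sum_(m : 'X_{1..3 < j.+1}) p@_m * form_coef m.

Lemma dual_form_scalar : scalar dual_form.
Proof.
move=> c p q; rewrite /dual_form mulr_sumr -big_split /=; apply: eq_bigr => m _.
by rewrite mcoeffD mcoeffZ mulrDl mulrA.
Qed.

Lemma dual_formX (m : 'X_{1..3}) : dual_form 'X_[m] = form_coef m.
Proof.
rewrite /dual_form; have [lt|ge] := ltnP (mdeg m) j.+1.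
  rewrite (bigD1 (BMultinom lt)) //= mcoeffX eqxx mul1r big1 ?addr0 // => m' m'm.
  by rewrite mcoeffX eq_sym (_ : (m' == m :> 'X_{1..3}) = false) ?mul0r //; apply/negbTE.
rewrite big1 => [|m' _]; first by rewrite /form_coef; case: eqP => // e; lia.
rewrite mcoeffX; case: eqP => [e|_]; last by rewrite mul0r.
by have := bmdeg m'; rewrite -e; lia.
Qed.

Lemma dual_formD p q : dual_form (p + q) = dual_form p + dual_form q.
Proof. by have := dual_form_scalar 1 p q; rewrite scale1r mul1r. Qed.
Lemma dual_form0 : dual_form 0 = 0.
Proof. by have := dual_form_scalar (-1) 0 0; rewrite scaler0 addr0 mulN1r addNr. Qed.
Lemma dual_formZ c p : dual_form (c *: p) = c * dual_form p.
Proof. by have := dual_form_scalar c p 0; rewrite !addr0 dual_form0 addr0. Qed.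

(** The largest ideal contained in the kernel of [dual_form]; testing against the
    monomials of degree at most [j] suffices, by [apolarP]. *)
Definition apolar (p : R) : bool := [forall m : 'X_{1..3 < j.+1}, dual_form (p * 'X_[m]) == 0].

Lemma dual_form_sum (T : Type) (r : seq T) (P : pred T) (G : T -> R) :
  dual_form (\sum_(i <- r | P i) G i) = \sum_(i <- r | P i) dual_form (G i).
Proof. by apply: (big_morph dual_form dual_formD dual_form0). Qed.

Lemma dual_form_big p m : (j < mdeg m)%N -> dual_form (p * 'X_[m]) = 0.
Proof.
move=> jm; rewrite [p]mpolyE mulr_suml dual_form_sum big1 // => m' _.
rewrite -scalerAl dual_formZ -mpolyXD dual_formX /form_coef mdegD.
by case: eqP => [|_]; rewrite ?mulr0 //; lia.
Qed.

Lemma apolarP p : reflect (forall q, dual_form (p * q) = 0) (apolar p).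
Proof.
apply: (iffP forallP) => [z q|z m]; last by rewrite z.
rewrite [q]mpolyE mulr_sumr dual_form_sum big1 // => m _.
rewrite -scalerAr dual_formZ; have [lt|ge] := ltnP (mdeg m) j.+1.
  by rewrite (eqP (z (BMultinom lt))) mulr0.
by rewrite dual_form_big ?mulr0.
Qed.

Variables (b1 c1 : nat).
Hypotheses (F1 : F b1 c1) (bc1 : (b1 + c1 < j)%N).

Lemma apolar_idealr : idealr_closed apolar.
Proof.
split=> [||a u v /apolarP au /apolarP av].
- by apply/apolarP => q; rewrite mul0r dual_form0.
- apply/apolarP => /(_ 'X_[mnm3 (j - b1 - c1) b1 c1]); rewrite mul1r dual_formX /form_coef.
  rewrite mdeg_mnm3 mnm3_y mnm3_z F1 (_ : (_ + _ + _ == j)%N) ?oner_eq0; last by lia.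
  by move/eqP; rewrite oner_eq0.
- by apply/apolarP => q; rewrite mulrDl dual_formD av addr0 -mulrA mulrCA au.
Qed.

Definition apolar_ideal : idealr R := HB.pack apolar (isIdealr.Build R apolar apolar_idealr).

Local Notation A := {ideal_quot apolar_ideal}.

Lemma in_apolar p : (p \in apolar_ideal) = apolar p. Proof. by []. Qed.

Lemma dual_form_pihomog d p m : dual_form (pihomog mdeg d p * 'X_[m]) =
   if (d + mdeg m == j)%N then dual_form (p * 'X_[m]) else 0.
Proof.
rewrite [p in LHS]mpolyE linear_sum mulr_suml dual_form_sum /=.
transitivity (\sum_(i <- msupp p) (if (d + mdeg m == j)%N then dual_form (p@_i *: 'X_[i] * 'X_[m]) else 0)).
  apply: eq_bigr => i _; rewrite linearZ /= pihomogX -!scalerAl !dual_formZ.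
  case: (eqVneq (mdeg i) d) => [e|ne].
    rewrite -mpolyXD dual_formX /form_coef mdegD e; case: eqP => // _; by rewrite mulr0.
  rewrite mul0r dual_form0 mulr0 -mpolyXD dual_formX /form_coef mdegD.
  by case: eqP => // e; case: eqP => e' //; [lia | rewrite mulr0].
case: ifP => _; last by rewrite big1.
by rewrite -dual_form_sum -mulr_suml -mpolyE.
Qed.

Lemma apolar_homogeneous : homogeneous_ideal apolar_ideal.
Proof.
move=> p; rewrite in_apolar => /apolarP pI d; rewrite in_apolar.
by apply/forallP => m; rewrite dual_form_pihomog; case: ifP => _; rewrite ?pI.
Qed.

Definition quot_form (a : A) : K := dual_form (repr a).

Lemma quot_form_pi p : quot_form (\pi_A p) = dual_form p.
Proof.
have : repr (\pi_A p) - p \in apolar_ideal by rewrite Quotient.idealrBE reprK.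
rewrite in_apolar => /apolarP /(_ 1); rewrite mulr1 dual_formD => /eqP.
have -> : dual_form (- p) = - dual_form p by rewrite -scaleN1r dual_formZ mulN1r.
by rewrite subr_eq0 => /eqP.
Qed.

Lemma quot_form_scalar : scalar quot_form.
Proof.
move=> c a b; rewrite -[a]reprK -[b]reprK -pi_scale -rmorphD !quot_form_pi.
exact: dual_form_scalar.
Qed.

Lemma quot_form_nondeg (a : A) : (forall b, quot_form (a * b) = 0) -> a = 0.
Proof.
rewrite -[a]reprK => z; apply/pi_eq0; rewrite in_apolar; apply/apolarP => q.
by rewrite -quot_form_pi rmorphM z.
Qed.

Lemma quot_form_degree d e (a b : A) : graded_piece d a -> graded_piece e b ->
  (d + e != j)%N -> quot_form (a * b) = 0.
Proof.
case=> p pd -> [q qe ->] de; rewrite -rmorphM quot_form_pi.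
have pq : p * q \is (d + e).-homog by rewrite dhomogM.
rewrite [p * q]mpolyE dual_form_sum big_seq big1 // => m /(dhomog_mf pq) /= md.
by rewrite dual_formZ dual_formX /form_coef md (negbTE de) mulr0.
Qed.

End Functional.

(** * A criterion for a type to occur *)

(** A dehomogenised form: a list of integer coefficients with exponents of y and
    z.  [homogenize] restores the power of x. *)
Definition dpoly := seq (int * (nat * nat)).

(** A family of strings of the same length, one starting in each degree from
    [fam_lo] to [fam_hi], with the generator in degree nu given by [fam_gen nu];
    [fam_dual] is the position of the family that it is paired with. *)
Record strand := Strand {
  fam_len : nat; fam_lo : nat; fam_hi : nat; fam_gen : nat -> dpoly;
  fam_dual : nat }.

(** The value of <F, pq>, when the degrees of [L] and [M] add up to that of F. *)
Definition gram (F : nat -> nat -> bool) (L M : dpoly) : int :=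
  \sum_(t <- L) \sum_(u <- M)
    t.1 * u.1 * (F (t.2.1 + u.2.1)%N (t.2.2 + u.2.2)%N)%:Z.

Definition no_strand := Strand 0 1 0 (fun=> [::]) 0.

Definition fam_types (fs : seq strand) : seq (nat * nat) :=
  flatten [seq up (fam_len f) (fam_lo f) (fam_hi f) | f <- fs].

Definition in_fam (fs : seq strand) (r nu : nat) : bool :=
  (r < size fs)%N && (fam_lo (nth no_strand fs r) <= nu <= fam_hi (nth no_strand fs r))%N.

(** The Gram matrix of the generators has one nonzero entry for each pair of dual
    generators, and no other.  Since l = x and F is dehomogenised in x, the entry
    of two generators is the pairing of x^i times one with the other for the only
    i that gives total degree [j]; the dual of a string of length p from degree nu runs
    from degree j + 1 - p - nu, and multiplying by x^i and x^(p-1-i) matches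
    their elements. *)
Record dual_system (j : nat) (F : nat -> nat -> bool) (fs : seq strand) : Prop := {
  ds_wf : forall r nu, in_fam fs r nu ->
    let f := nth no_strand fs r in
    [/\ (0 < fam_len f)%N, all (fun t => t.2.1 + t.2.2 <= nu)%N (fam_gen f nu),
        in_fam fs (fam_dual f) (j + 1 - fam_len f - nu), (nu + fam_len f <= j + 1)%N &
        fam_dual (nth no_strand fs (fam_dual f)) = r /\
        fam_len (nth no_strand fs (fam_dual f)) = fam_len f];
  ds_gram : forall r nu r' nu', in_fam fs r nu -> in_fam fs r' nu' -> (nu + nu' <= j)%N ->
    let f := nth no_strand fs r in
    let f' := nth no_strand fs r' in
    (gram F (fam_gen f nu) (fam_gen f' nu') != 0) =
    (r' == fam_dual f) && (nu + nu' + fam_len f == j + 1)%N }.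

(** In degree [d], modulo the apolar ideal, each monomial is zero or equal to one
    of at most [m] monomials.  A monomial of degree [d] is tested against those
    of degree j - d. *)
Definition spanned (j : nat) (F : nat -> nat -> bool) (m : nat) (d : nat) : Prop :=
  exists U : seq (nat * nat),
    [/\ (size U <= m)%N, all (fun u => u.1 + u.2 <= d)%N U &
     forall b c, (b + c <= d)%N ->
       (forall b' c', (b' + c' + d <= j)%N -> F (b + b')%N (c + c')%N = false) \/
       exists2 u, u \in U & forall b' c', (b' + c' + d <= j)%N ->
           F (b + b')%N (c + c')%N = F (u.1 + b')%N (u.2 + c')%N].

(** Linear algebra in the apolar quotient, with basis the elements x^i v of the
    strings, indexed by ((family, starting degree), i). *)
Section Criterion.
Variables (K : fieldType) (charK : [pchar K] =i pred0) (k j : nat).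
Hypotheses (k0 : (0 < k)%N) (hj : j = (k + 3)%N).
Variables (F : nat -> nat -> bool) (b1 c1 : nat) (F1 : F b1 c1) (bc1 : (b1 + c1 < j)%N).
Variable fs : seq strand.
Hypothesis DS : dual_system j F fs.
Hypothesis hilb : forall d, string_rank (fam_types fs) 0 d = nth 0%N (T4 k) d.
Hypothesis span_mid : forall d, (2 <= d)%N -> (d + 2 <= j)%N -> spanned j F 4 d.
Local Notation R := {mpoly K[3]}.
Local Notation I := (apolar_ideal K j F b1 c1 F1 bc1).
Local Notation A := {ideal_quot I}.
Local Notation quot_form := (quot_form K j F b1 c1 F1 bc1).
Local Notation dual_form := (dual_form K j F).

Lemma intr_neq0 (c : int) : (c%:~R == 0 :> K) = (c == 0).
Proof.
have natr n : (n%:R == 0 :> K) = (n == 0)%N by apply: (pcharf0P K).1.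
case: c => n; first exact: natr.
by change ((- (n.+1%:R : K) == 0) = (Negz n == 0)); rewrite oppr_eq0 natr.
Qed.

Definition homogenize (nu : nat) (L : dpoly) : R :=
  \sum_(t <- L) t.1%:~R *: 'X_[mnm3 (nu - t.2.1 - t.2.2) t.2.1 t.2.2].

Lemma homogenize_homog nu L : all (fun t => t.2.1 + t.2.2 <= nu)%N L -> homogenize nu L \is nu.-homog.
Proof.
move=> /allP wf; rewrite /homogenize big_seq; apply: rpred_sum => t tL; apply: dhomogZ.
by rewrite dhomogX /= mdeg_mnm3; apply/eqP; have := wf t tL; lia.
Qed.

Lemma Xn_mnm3 i : 'X_ord0 ^+ i = 'X_[mnm3 i 0 0] :> R.
Proof.
rewrite mpolyXn; congr ('X_[_]); apply/mnmP => t; rewrite mulmnE mnm1E.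
by case: t => -[|[|[|//]]] ?; rewrite mnmE /= ?mul1n ?mul0n.
Qed.

Lemma dual_form_homogenize i nu L i' nu' L' :
  all (fun t => t.2.1 + t.2.2 <= nu)%N L -> all (fun t => t.2.1 + t.2.2 <= nu')%N L' ->
  dual_form ('X_ord0 ^+ i * homogenize nu L * ('X_ord0 ^+ i' * homogenize nu' L')) =
  if (i + nu + (i' + nu') == j)%N then (gram F L L')%:~R else 0.
Proof.
move=> /allP wf /allP wf'.
have -> : 'X_ord0 ^+ i * homogenize nu L * ('X_ord0 ^+ i' * homogenize nu' L') =
  \sum_(t <- L) \sum_(u <- L') (t.1 * u.1)%:~R *:
    'X_[mnm3 (i + i' + (nu - t.2.1 - t.2.2) + (nu' - u.2.1 - u.2.2))
            (t.2.1 + u.2.1) (t.2.2 + u.2.2)].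
  rewrite mulrACA -exprD /homogenize big_distrlr /= mulr_sumr; apply: eq_bigr => t _.
  rewrite mulr_sumr; apply: eq_bigr => u _.
  rewrite -scalerAl -!scalerAr scalerA -intrM Xn_mnm3 -!mpolyXD !mnm3M.
  by rewrite !add0n addnA.
rewrite (dual_form_sum K j F) /gram rmorph_sum big_seq.
transitivity (\sum_(t <- L | t \in L) \sum_(u <- L')
   (if (i + nu + (i' + nu') == j)%N then
    (t.1 * u.1 * (F (t.2.1 + u.2.1)%N (t.2.2 + u.2.2)%N)%:Z)%:~R else 0 : K)).
  apply: eq_bigr => t tL; rewrite (dual_form_sum K j F) big_seq [RHS]big_seq.
  apply: eq_bigr => u uL; rewrite dual_formZ dual_formX /form_coef mdeg_mnm3 mnm3_y mnm3_z.
  have := wf t tL; have := wf' u uL => ??.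
  rewrite (_ : (_ + _ == j)%N = (i + nu + (i' + nu') == j)%N); last by congr (_ == _); lia.
  by case: ifP => _; rewrite ?mulr0 // [RHS]intrM.
rewrite -big_seq; case: ifP => _; last by rewrite big1 // => t _; rewrite big1.
by apply: eq_bigr => t _; rewrite rmorph_sum.
Qed.
Local Notation strand_at := (nth no_strand fs).

Definition lin_x : A := \pi_A 'X_ord0.

Definition gen_indices : seq (nat * nat) :=
  [seq (r, nu) | r <- iota 0 (size fs), nu <- index_iota (fam_lo (strand_at r)) (fam_hi (strand_at r)).+1].

Definition elt_indices : seq (nat * nat * nat) :=
  [seq (x, i) | x <- gen_indices, i <- iota 0 (fam_len (strand_at x.1))].

Lemma mem_gen_indices r nu : ((r, nu) \in gen_indices) = in_fam fs r nu.
Proof.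
apply/allpairsPdep/idP => [[r' [nu' [r'i nui [-> ->]]]]|].
  by move: r'i nui; rewrite mem_iota mem_index_iota /in_fam; lia.
move=> h; exists r, nu; split=> //; move: h; rewrite /in_fam mem_iota ?mem_index_iota; lia.
Qed.

Lemma uniq_gen_indices : uniq gen_indices.
Proof.
apply: allpairs_uniq_dep => [|r _|]; [exact: iota_uniq|exact: iota_uniq|].
by move=> [r nu] [r' nu'] _ _ /= [-> ->].
Qed.

Lemma mem_elt_indices r nu i : ((r, nu, i) \in elt_indices) = in_fam fs r nu && (i < fam_len (strand_at r))%N.
Proof.
rewrite -mem_gen_indices; apply/allpairsPdep/idP => [[[r' nu'] [i' [xI i'i [-> -> ->]]]]|].
  by rewrite xI /=; move: i'i; rewrite mem_iota.
by case/andP=> xI ii; exists (r, nu), i; split=> //; rewrite mem_iota.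
Qed.

Lemma uniq_elt_indices : uniq elt_indices.
Proof.
apply: allpairs_uniq_dep => [|r _|]; [exact: uniq_gen_indices|exact: iota_uniq|].
by move=> [r nu] [r' nu'] _ _ /= [-> ->].
Qed.

Definition strand_gen (x : nat * nat) : A := \pi_A (homogenize x.2 (fam_gen (strand_at x.1) x.2)).
Definition strand_elt (e : nat * nat * nat) : A := lin_x ^+ e.2 * strand_gen e.1.
Definition elt_deg (e : nat * nat * nat) : nat := (e.1.2 + e.2)%N.
(** The index of the element of complementary degree that pairs nontrivially. *)
Definition dual_index (e : nat * nat * nat) : nat * nat * nat :=
  let f := strand_at e.1.1 in
  ((fam_dual f, j + 1 - fam_len f - e.1.2)%N, (fam_len f - 1 - e.2)%N).

Lemma dual_index_in e : e \in elt_indices -> dual_index e \in elt_indices.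
Proof.
case: e => -[r nu] i; rewrite !mem_elt_indices /dual_index /= => /andP[h ii].
have [p0 _ -> _ [_ ->]] := ds_wf _ _ _ DS _ _ h; lia.
Qed.

Lemma dual_indexK e : e \in elt_indices -> dual_index (dual_index e) = e.
Proof.
case: e => -[r nu] i; rewrite !mem_elt_indices /dual_index /= => /andP[h ii].
have [p0 _ _ hp [-> ->]] := ds_wf _ _ _ DS _ _ h.
by congr (_, _, _); lia.
Qed.

Lemma elt_deg_dual e : e \in elt_indices -> (elt_deg e + elt_deg (dual_index e) = j)%N.
Proof.
case: e => -[r nu] i; rewrite !mem_elt_indices /elt_deg /dual_index /= => /andP[h ii].
have [p0 _ _ hp _] := ds_wf _ _ _ DS _ _ h; lia.
Qed.

Lemma lin_x_piece i : graded_piece i (lin_x ^+ i).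
Proof.
exists ('X_ord0 ^+ i); last by rewrite rmorphXn.
by rewrite Xn_mnm3 dhomogX /= mdeg_mnm3 !addn0.
Qed.

Lemma strand_gen_piece r nu : in_fam fs r nu -> graded_piece nu (strand_gen (r, nu)).
Proof.
move=> h; have [_ wf _ _ _] := ds_wf _ _ _ DS _ _ h.
by exists (homogenize nu (fam_gen (strand_at r) nu)) => //; exact: homogenize_homog.
Qed.

Lemma strand_elt_piece e : e \in elt_indices -> graded_piece (elt_deg e) (strand_elt e).
Proof.
case: e => -[r nu] i; rewrite mem_elt_indices => /andP[h _]; rewrite /elt_deg addnC.
by apply: graded_pieceM; [exact: lin_x_piece|exact: strand_gen_piece].
Qed.

Lemma quot_form_gen r nu i r' nu' i' : in_fam fs r nu -> in_fam fs r' nu' ->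
  quot_form (lin_x ^+ i * strand_gen (r, nu) * (lin_x ^+ i' * strand_gen (r', nu'))) =
  if (i + nu + (i' + nu') == j)%N
  then (gram F (fam_gen (strand_at r) nu) (fam_gen (strand_at r') nu'))%:~R else 0.
Proof.
move=> h h'; have [_ wf _ _ _] := ds_wf _ _ _ DS _ _ h.
have [_ wf' _ _ _] := ds_wf _ _ _ DS _ _ h'.
by rewrite -dual_form_homogenize // -(quot_form_pi K j F b1 c1 F1 bc1) !rmorphM !rmorphXn.
Qed.

Lemma quot_form_elt e e' : e \in elt_indices -> e' \in elt_indices ->
  (quot_form (strand_elt e * strand_elt e') != 0) = (e' == dual_index e).
Proof.
case: e e' => -[r nu] i [[r' nu'] i']; rewrite !mem_elt_indices => /andP[h ii] /andP[h' ii'].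
rewrite /strand_elt /= quot_form_gen // /dual_index /= !xpair_eqE.
have [p0 _ _ hp _] := ds_wf _ _ _ DS _ _ h.
case: (eqVneq (i + nu + (i' + nu'))%N j) => [e|/eqP ne].
  transitivity (gram F (fam_gen (strand_at r) nu) (fam_gen (strand_at r') nu') != 0).
    by congr (~~ _); exact: intr_neq0.
  rewrite (ds_gram _ _ _ DS) //; last by lia.
  by case: eqP => //= _; lia.
rewrite eqxx; symmetry; apply/negP => /andP[/andP[_ /eqP e1] /eqP e2].
by apply: ne; lia.
Qed.

Definition dual_pairing (e : nat * nat * nat) (a : A) : K := quot_form (strand_elt (dual_index e) * a).

Lemma dual_pairing_scalar e : scalar (dual_pairing e).
Proof.
move=> c a b; rewrite /dual_pairing mulrDr -(quot_form_scalar K j F b1 c1 F1 bc1).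
by rewrite -scalerAr.
Qed.

Lemma dual_pairing_elt e e' : e \in elt_indices -> e' \in elt_indices ->
  (dual_pairing e (strand_elt e') != 0) = (e == e').
Proof.
by move=> eE e'in; rewrite /dual_pairing quot_form_elt ?dual_index_in // dual_indexK // eq_sym.
Qed.
Definition self_pairing e : K := dual_pairing e (strand_elt e).

Definition dual_coef (e : nat * nat * nat) (a : A) : K := dual_pairing e a / self_pairing e.

(** The projection on the span of the strings along the orthogonal of their duals;
    the strings span where it is the identity. *)
Definition expand (a : A) : A := \sum_(e <- elt_indices) dual_coef e a *: strand_elt e.

Lemma dual_coef_scalar e : scalar (dual_coef e).
Proof. by move=> c a b; rewrite /dual_coef dual_pairing_scalar mulrDl -mulrA. Qed.

Lemma dual_coef_elt e e' : e \in elt_indices -> e' \in elt_indices ->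
  dual_coef e (strand_elt e') = (e == e')%:R.
Proof.
move=> eE e'in; rewrite /dual_coef; have := dual_pairing_elt e e' eE e'in.
case: (eqVneq e e') => [<-|ne] /=; first by move=> k0'; rewrite /self_pairing divff.
by move/negbFE/eqP => ->; rewrite mul0r.
Qed.

Lemma expand_linear : linear expand.
Proof.
move=> c a b; rewrite /expand scaler_sumr -big_split /=; apply: eq_bigr => e _.
by rewrite dual_coef_scalar scalerDl scalerA.
Qed.

Lemma expand0 : expand 0 = 0.
Proof. by have := expand_linear (-1) 0 0; rewrite scaler0 addr0 scaleN1r addNr. Qed.

Lemma expand_sum (J : Type) (r : seq J) (P : pred J) (c : J -> K) (v : J -> A) :
  (forall i, P i -> expand (v i) = v i) ->
  expand (\sum_(i <- r | P i) c i *: v i) = \sum_(i <- r | P i) c i *: v i.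
Proof.
move=> hv; elim/big_rec: _ => [|i x Pi hx]; last by rewrite expand_linear hx hv.
by have := expand_linear (-1) 0 0; rewrite scaler0 addr0 scaleN1r addNr.
Qed.

Lemma expand_elt e : e \in elt_indices -> expand (strand_elt e) = strand_elt e.
Proof.
move=> eE; rewrite /expand (bigD1_seq e) ?uniq_elt_indices //= dual_coef_elt // eqxx scale1r.
rewrite big_seq_cond big1 ?addr0 // => e' /andP[e'in ne].
by rewrite dual_coef_elt // (negbTE ne) scale0r.
Qed.

Lemma dual_coef_deg e d a : e \in elt_indices -> graded_piece d a -> elt_deg e != d -> dual_coef e a = 0.
Proof.
move=> eE ad ne; rewrite /dual_coef /dual_pairing.
rewrite (quot_form_degree K j F b1 c1 F1 bc1 _ _ _ _
  (strand_elt_piece _ (dual_index_in _ eE)) ad).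
  by rewrite mul0r.
have ds := elt_deg_dual e eE; move: ne; apply: contraNneq => e1; apply/eqP; lia.
Qed.

Definition deg_indices d := [seq e <- elt_indices | elt_deg e == d].

Lemma fam_typesE : fam_types fs = [seq (fam_len (strand_at x.1), x.2) | x <- gen_indices].
Proof.
rewrite /gen_indices map_flatten -map_comp /fam_types -{1}(mkseq_nth no_strand fs) /mkseq -map_comp.
by congr flatten; apply: eq_map => r /=; rewrite -map_comp.
Qed.

Lemma count_start nu p d :
  count (fun i => nu + i == d)%N (iota 0 p) = ((nu <= d) && (d < nu + p))%N.
Proof.
elim: p => [|p IH]; first by rewrite /= addn0; case: (leqP nu d).
by rewrite -[p.+1]addn1 iotaD count_cat IH /= addn0 add0n; case: eqP; lia.
Qed.

Lemma size_deg_indices d : size (deg_indices d) = nth 0%N (T4 k) d.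
Proof.
rewrite -hilb size_filter fam_typesE /string_rank count_map /elt_indices.
elim: (gen_indices) => //= x s IH; rewrite count_cat IH count_map addn0; congr (_ + _)%N.
exact: count_start.
Qed.

Lemma pi_mnm3_eq d b c b' c' : (b + c <= d)%N -> (b' + c' <= d)%N ->
  (forall x y, (x + y + d <= j)%N -> F (b + x) (c + y) = F (b' + x) (c' + y)) ->
  \pi_A 'X_[mnm3 (d - b - c) b c] = \pi_A 'X_[mnm3 (d - b' - c') b' c'].
Proof.
move=> h h' FF; apply/eqP; rewrite -subr_eq0 -rmorphB; apply/eqP/pi_eq0.
rewrite in_apolar; apply/forallP => m.
rewrite mulrBl dual_formD -scaleN1r dual_formZ mulN1r subr_eq0 -!mpolyXD !dual_formX /form_coef !mdegD !mdeg_mnm3.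
have -> : (d - b - c + b + c = d)%N by lia.
have -> : (d - b' - c' + b' + c' = d)%N by lia.
case: (eqVneq (d + mdeg m)%N j) => // e; rewrite !mnmDE !mnm3_y !mnm3_z FF //.
by move: e; rewrite mdeg3; lia.
Qed.

Lemma pi_mnm3_eq0 d b c : (b + c <= d)%N ->
  (forall x y, (x + y + d <= j)%N -> F (b + x) (c + y) = false) ->
  \pi_A 'X_[mnm3 (d - b - c) b c] = 0.
Proof.
move=> h FF; apply/pi_eq0; rewrite in_apolar; apply/forallP => m.
rewrite -!mpolyXD !dual_formX /form_coef !mdegD !mdeg_mnm3.
have -> : (d - b - c + b + c = d)%N by lia.
case: (eqVneq (d + mdeg m)%N j) => // e; rewrite !mnmDE !mnm3_y !mnm3_z FF //.
by move: e; rewrite mdeg3; lia.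
Qed.

Lemma homog_mnm3 d p : p \is d.-homog -> \pi_A p =
  \sum_(m <- msupp p | mdeg m == d) p@_m *: \pi_A 'X_[mnm3 (d - m idx_y - m idx_z) (m idx_y) (m idx_z)].
Proof.
move=> pd; rewrite {1}[p]mpolyE rmorph_sum big_seq [RHS]big_seq_cond /=.
apply: eq_big => [m|m mp].
  by case mp: (m \in msupp p) => //=; rewrite (dhomog_mf pd mp) eqxx.
have -> : (d - m idx_y - m idx_z = m ord0)%N.
  by have := dhomog_mf pd mp; rewrite /= mdeg3; lia.
by rewrite pi_scale -mnm3E.
Qed.

(** In a degree spanned by as few monomials as there are string elements, these
    elements span by [dual_span]. *)
Lemma expand_low d m : spanned j F m d -> (m <= size (deg_indices d))%N ->
   forall a, graded_piece d a -> expand a = a.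
Proof.
case=> U [szU /allP wfU cover] m_le a [p pd ->].
rewrite (homog_mnm3 _ _ pd); apply: expand_sum => mm /eqP mmd.
have {mmd} bc : (mm idx_y + mm idx_z <= d)%N by rewrite -mmd mdeg3; lia.
have [z|[u uU uE]] := cover _ _ bc.
  by rewrite pi_mnm3_eq0 // expand0.
rewrite (pi_mnm3_eq _ _ _ u.1 u.2) //; last exact: wfU.
pose uu (i : 'I_(size U)) : A := let v := nth (0, 0)%N U i in
   \pi_A 'X_[mnm3 (d - v.1 - v.2) v.1 v.2].
pose ee (i : 'I_(size (deg_indices d))) := nth (0, 0, 0)%N (deg_indices d) i.
have eeE i : ee i \in deg_indices d by apply: mem_nth.
have eeP i : ee i \in elt_indices /\ elt_deg (ee i) = d.
  by have := eeE i; rewrite mem_filter => /andP[/eqP].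
have ui : (index u U < size U)%N by rewrite index_mem.
have [|||i|c cE] := dual_span K A (size U) (size (deg_indices d)) uu (fun i => strand_elt (ee i))
   (fun i => dual_pairing (ee i)) _ _ _ _ (Ordinal ui).
- exact: leq_trans szU m_le.
- by move=> i; exact: dual_pairing_scalar.
- move=> i1 i2; rewrite dual_pairing_elt ?(proj1 (eeP _)) // eq_sym.
  by rewrite /ee nth_uniq // filter_uniq // uniq_elt_indices.
- have [q qd ->] : graded_piece d (strand_elt (ee i)).
    by have := strand_elt_piece _ (proj1 (eeP i)); rewrite (proj2 (eeP i)).
  rewrite (homog_mnm3 _ _ qd).
  elim/big_rec: _ => [|m' x /eqP m'd [c ->]].
    by exists (fun=> 0); rewrite big1 // => t _; rewrite scale0r.
  have bc' : (m' idx_y + m' idx_z <= d)%N by rewrite -m'd mdeg3; lia.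
  have [z'|[u' u'U u'elt_indices]] := cover _ _ bc'.
    by exists c; rewrite pi_mnm3_eq0 // scaler0 add0r.
  have ui' : (index u' U < size U)%N by rewrite index_mem.
  exists (fun t => q@_m' * (t == Ordinal ui')%:R + c t).
  transitivity (\sum_t (q@_m' * (t == Ordinal ui')%:R) *: uu t + \sum_t c t *: uu t).
    congr (_ + _); rewrite (bigD1 (Ordinal ui')) //= eqxx mulr1 big1 => [|t /negbTE ->].
      rewrite addr0 /uu /= nth_index //; congr (_ *: _).
      by apply: pi_mnm3_eq => //; exact: wfU.
    by rewrite mulr0 scale0r.
  by rewrite -big_split; apply: eq_bigr => t _; rewrite scalerDl.
have -> : \pi_A 'X_[mnm3 (d - u.1 - u.2) u.1 u.2] = uu (Ordinal ui).
  by rewrite /uu /= nth_index.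
rewrite cE; apply: expand_sum => i _; apply: expand_elt; exact: (proj1 (eeP i)).
Qed.

(** If the strings span in degree j - d, then a - [expand a] is orthogonal to
    everything when a has degree [d], hence zero. *)
Lemma expand_dual d : (d <= j)%N -> (forall a, graded_piece (j - d) a -> expand a = a) ->
   forall a, graded_piece d a -> expand a = a.
Proof.
move=> dj dual a ad; apply/esym/eqP; rewrite -subr_eq0; apply/eqP.
apply: (quot_form_nondeg K j F b1 c1 F1 bc1) => b.
have lin0 : quot_form 0 = 0.
  by have := quot_form_scalar K j F b1 c1 F1 bc1 (-1) 0 0; rewrite scaler0 addr0 mulN1r addNr.
have psiD x y : quot_form (x + y) = quot_form x + quot_form y.
  by have := quot_form_scalar K j F b1 c1 F1 bc1 1 x y; rewrite scale1r mul1r.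
have psiB x y : quot_form (x - y) = quot_form x - quot_form y.
  by have := quot_form_scalar K j F b1 c1 F1 bc1 (-1) y x; rewrite scaleN1r mulN1r (addrC (- y)) (addrC (- quot_form y)).
have bs : b = \sum_(m <- msupp (repr b)) (repr b)@_m *: \pi_A 'X_[m].
  by rewrite -[LHS]reprK {1}[repr b]mpolyE rmorph_sum; apply: eq_bigr => m _; exact: pi_scale.
rewrite bs mulr_sumr (big_morph quot_form psiD lin0) big1 // => m _.
rewrite -scalerAr; have -> c x : quot_form (c *: x) = c * quot_form x.
  by have := quot_form_scalar K j F b1 c1 F1 bc1 c x 0; rewrite addr0 lin0 addr0.
set g : A := \pi_A _; have gd : graded_piece (mdeg m) g.
  by exists 'X_[m] => //; rewrite dhomogX.
suff -> : quot_form ((a - expand a) * g) = 0 by rewrite mulr0.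
have expg : quot_form (expand a * g) = \sum_(e <- elt_indices) dual_coef e a * quot_form (strand_elt e * g).
  rewrite /expand mulr_suml -(scalar_sum K A quot_form (quot_form_scalar K j F b1 c1 F1 bc1)).
  by congr (quot_form _); apply: eq_bigr => e _; rewrite -scalerAl.
have [md|md] := eqVneq (d + mdeg m)%N j; last first.
  rewrite mulrBl psiB (quot_form_degree K j F b1 c1 F1 bc1 _ _ _ _ ad gd) // expg big_seq big1 ?subrr // => e eE.
  have [de|ne] := eqVneq (elt_deg e) d; last by rewrite (dual_coef_deg _ _ _ eE ad ne) mul0r.
  rewrite (quot_form_degree K j F b1 c1 F1 bc1 _ _ _ _ (strand_elt_piece _ eE) gd) ?mulr0 //.
  by rewrite de.
have gg : expand g = g by apply: dual; rewrite (_ : j - d = mdeg m)%N //; lia.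
have pa e : e \in elt_indices -> quot_form ((a - expand a) * strand_elt e) = 0.
  move=> eE; have sE := dual_index_in _ eE.
  have pe x : quot_form (x * strand_elt e) = dual_pairing (dual_index e) x by rewrite /dual_pairing dual_indexK // mulrC.
  have pl := dual_pairing_scalar (dual_index e).
  rewrite pe; have -> : a - expand a = (-1) *: expand a + a by rewrite scaleN1r addrC.
  rewrite pl /expand (scalar_sum K A _ pl) (bigD1_seq _ sE uniq_elt_indices) /=.
  rewrite big_seq_cond big1 => [|e' /andP[e'in ne]]; last first.
    have := dual_pairing_elt _ _ sE e'in; rewrite [dual_index e == _]eq_sym (negbTE ne) => /negbFE/eqP ->.
    by rewrite mulr0.
  rewrite addr0 /dual_coef divfK ?mulN1r ?addNr //.
  by rewrite /self_pairing dual_pairing_elt // eqxx.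
rewrite -gg {1}/expand mulr_sumr (big_morph quot_form psiD lin0) big_seq big1 // => e eE.
rewrite -scalerAr; have := quot_form_scalar K j F b1 c1 F1 bc1 (dual_coef e g) ((a - expand a) * strand_elt e) 0.
by rewrite addr0 lin0 addr0 => ->; rewrite pa // mulr0.
Qed.
Lemma nthT4_mid d : (2 <= d)%N -> (d + 2 <= j)%N -> nth 0%N (T4 k) d = 4.
Proof.
case: d => [|[|d]] // _ dj; rewrite /T4 /= nth_cat size_nseq nth_nseq.
by have -> : (d < k)%N by lia.
Qed.

Lemma expand_piece d a : graded_piece d a -> expand a = a.
Proof.
have ex0 b : graded_piece 0 b -> expand b = b.
  apply: (expand_low 0 1); last by rewrite size_deg_indices.
  exists [:: (0, 0)%N]; split=> // x y; rewrite leqn0 addn_eq0 => /andP[/eqP -> /eqP ->].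
  by right; exists (0, 0)%N; rewrite ?inE.
have ex1 b : graded_piece 1 b -> expand b = b.
  apply: (expand_low 1 3); last by rewrite size_deg_indices.
  exists [:: (0, 0); (1, 0); (0, 1)]%N; split=> // x y xy.
  right; exists (x, y) => //.
  by move: x y xy => [|[|x]] [|[|y]].
have [d_gt ad|dj] := ltnP j d.
  case: ad => p pd ->; rewrite (homog_mnm3 _ _ pd); apply: expand_sum => m /eqP md.
  by rewrite pi_mnm3_eq0 ?expand0 // => [|x y]; [rewrite -md mdeg3|]; lia.
have [d_lt2|d_ge2] := ltnP d 2.
  by case: d d_lt2 {dj} => [|[|//]] _; [apply: ex0|apply: ex1].
have [d_mid|d_top] := leqP (d + 2) j.
  by apply: (expand_low d 4); [exact: span_mid | rewrite size_deg_indices nthT4_mid].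
apply: expand_dual => // b bd.
by have [e|e] : (j - d = 0 \/ j - d = 1)%N by [lia]; rewrite e in bd; [apply: ex0|apply: ex1].
Qed.

Lemma expand_all a : expand a = a.
Proof.
rewrite -[a]reprK [repr a]mpolyE rmorph_sum /=.
transitivity (expand (\sum_(m <- msupp (repr a)) (repr a)@_m *: \pi_A 'X_[m])).
  by congr expand; apply: eq_bigr => m _; exact: pi_scale.
rewrite expand_sum => [|m _]; first by apply: eq_bigr => m _; rewrite pi_scale.
by apply: (expand_piece (mdeg m)); exists 'X_[m]; rewrite ?dhomogX.
Qed.

Lemma basis_elts : is_basis (fun _ : A => True) [seq strand_elt e | e <- elt_indices].
Proof.
apply: (dual_basis K A _ _ elt_indices strand_elt dual_pairing uniq_elt_indices) => [e||//|v _].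
- exact: dual_pairing_scalar.
- by move=> e e' eE e'in; rewrite dual_pairing_elt.
- by exists (fun e => dual_coef e v); rewrite -[LHS]expand_all.
Qed.

Lemma basis_deg_elts d : is_basis (@graded_piece K 3 I d) [seq strand_elt e | e <- deg_indices d].
Proof.
have sub e : e \in deg_indices d -> e \in elt_indices by rewrite mem_filter => /andP[].
apply: (dual_basis K A _ _ (deg_indices d) strand_elt dual_pairing) => [||e e' eE e'in|e|v vd].
- by rewrite filter_uniq // uniq_elt_indices.
- by move=> e; exact: dual_pairing_scalar.
- by rewrite dual_pairing_elt ?sub.
- by rewrite mem_filter => /andP[/eqP <-]; apply: strand_elt_piece.
exists (fun e => dual_coef e v); rewrite -[LHS]expand_all /expand big_filter [RHS]big_mkcond /=.
rewrite big_seq [RHS]big_seq; apply: eq_bigr => e eE; case: eqP => // /eqP ne.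
by rewrite (dual_coef_deg _ _ _ eE vd ne) scale0r.
Qed.

Lemma lin_x_neq0 : lin_x != 0.
Proof.
apply/eqP => /pi_eq0; rewrite in_apolar => /apolarP /(_ 'X_[mnm3 (j - b1 - c1 - 1) b1 c1]).
rewrite -['X_ord0]expr1 Xn_mnm3 -mpolyXD mnm3M dual_formX /form_coef mdeg_mnm3 mnm3_y mnm3_z !add0n F1.
have -> : (1 + (j - b1 - c1 - 1) + b1 + c1 == j)%N by apply/eqP; lia.
by move/eqP; rewrite oner_eq0.
Qed.

Definition top_class : A := \pi_A 'X_[mnm3 (j - b1 - c1) b1 c1].

Lemma quot_form_top : quot_form top_class = 1.
Proof.
rewrite quot_form_pi dual_formX /form_coef mdeg_mnm3 mnm3_y mnm3_z F1.
by have -> : (j - b1 - c1 + b1 + c1 == j)%N by apply/eqP; lia.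
Qed.

Lemma socle_top : socle top_class.
Proof.
move=> _ [q q0 ->]; apply: (quot_form_nondeg K j F b1 c1 F1 bc1) => b.
rewrite -[b]reprK -!rmorphM quot_form_pi [q]mpolyE !mulr_suml (dual_form_sum K j F) big1_seq // => m.
rewrite andTb => mq; rewrite -!scalerAl dual_formZ -mpolyXD [_ * repr b]mulrC dual_form_big ?mulr0 //.
have m0 : mdeg m != 0%N.
  by rewrite mdeg_eq0; apply: contraTneq mq => ->; rewrite mcoeff_msupp q0 eqxx.
by rewrite mdegD mdeg_mnm3; lia.
Qed.

Lemma socle_psi a : socle a -> quot_form a = 0 -> a = 0.
Proof.
move=> sa a0; apply: (quot_form_nondeg K j F b1 c1 F1 bc1) => b.
rewrite -[b]reprK; set r := repr b.
have -> : a * \pi_A r = r@_0%MM *: a.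
  apply/eqP; rewrite -subr_eq0; apply/eqP.
  have -> : a * \pi_A r - r@_0%MM *: a = \pi_A (r - (r@_0%MM)%:MP) * a.
    rewrite rmorphB mulrBl mulrC; congr (_ - _).
  apply: sa; exists (r - (r@_0%MM)%:MP) => //.
  by rewrite mcoeffB mcoeffC eqxx mulr1 subrr.
have := quot_form_scalar K j F b1 c1 F1 bc1 (r@_0%MM) a 0; rewrite addr0 => ->.
have := quot_form_scalar K j F b1 c1 F1 bc1 (-1) 0 0; rewrite scaler0 addr0 mulN1r addNr => ->.
by rewrite a0 mulr0 addr0.
Qed.

Lemma apolar_gorenstein : gorenstein I.
Proof.
exists [:: top_class] => //; split=> [[[|//] i]|v sv]; first exact: socle_top.
have line c : quot_form (c *: top_class) = c.
  have := quot_form_scalar K j F b1 c1 F1 bc1 c top_class 0; rewrite addr0 quot_form_top mulr1 => ->.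
  have := quot_form_scalar K j F b1 c1 F1 bc1 (-1) 0 0; rewrite scaler0 addr0 mulN1r addNr => ->.
  by rewrite addr0.
have E1 (c : {ffun 'I_(size [:: top_class]) -> K}) :
    \sum_(i < size [:: top_class]) c i *: [:: top_class]`_i = c ord0 *: top_class.
  exact: (big_ord1 _ (fun i : 'I_1 => c i *: [:: top_class]`_i)).
exists [ffun=> quot_form v]; split; first rewrite E1 ffunE.
  apply/eqP; rewrite -subr_eq0; apply/eqP/socle_psi.
    by move=> b bi; rewrite mulrBr sv // -scalerAr socle_top // scaler0 subr0.
  have := quot_form_scalar K j F b1 c1 F1 bc1 (-1) (quot_form v *: top_class) v.
  by rewrite scaleN1r (addrC v) => ->; rewrite line mulN1r addNr.
by move=> c; rewrite E1 => ->; apply/ffunP => i; rewrite ffunE line [i]ord1.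
Qed.

Lemma string_elts :
  flatten [seq string lin_x x.1 x.2.1 |
    x <- [seq (strand_gen x, (fam_len (strand_at x.1), x.2)) | x <- gen_indices]]
  = [seq strand_elt e | e <- elt_indices].
Proof.
rewrite /elt_indices map_flatten -!map_comp; congr flatten; apply: eq_map => x /=.
by rewrite -map_comp.
Qed.

(** The product pairs to zero with the string elements: a nonzero Gram entry needs
    two strings of the same length whose generators are at the right distance,
    which is one less than the power considered. *)
Lemma strand_gen_string r nu : in_fam fs r nu -> lin_x ^+ fam_len (strand_at r) * strand_gen (r, nu) = 0.
Proof.
move=> h; have [p0 wf _ hp _] := ds_wf _ _ _ DS _ _ h.
rewrite -[LHS]expand_all /expand big_seq big1 // => -[[r' nu'] i'] e'in.
rewrite /dual_coef /dual_pairing; have := dual_index_in _ e'in; case: (dual_index _) => -[r2 nu2] i2.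
rewrite mem_elt_indices => /andP[h2 ii2]; rewrite /strand_elt quot_form_gen //.
case: eqP => [e|_]; last by rewrite mul0r scale0r.
have := ds_gram _ _ _ DS _ _ _ _ h2 h; rewrite (_ : (nu2 + nu <= j)%N); last by lia.
move=> /(_ isT) g; have [_ _ _ _ [_ len2]] := ds_wf _ _ _ DS _ _ h2.
suff /eqP -> : gram F (fam_gen (strand_at r2) nu2) (fam_gen (strand_at r) nu) == 0.
  by rewrite mul0r scale0r.
apply: negbFE; rewrite g; apply/negP => /andP[/eqP r2E /eqP g2].
by move: len2 e; rewrite /= -r2E; lia.
Qed.

Theorem dual_system_occurring : occurring K (T4 k) (seq_mset (fam_types fs)).
Proof.
exists I.
  split; [exact: apolar_homogeneous| |exact: apolar_gorenstein|].
    exists (size [seq strand_elt e | e <- elt_indices]).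
    by exists [seq strand_elt e | e <- elt_indices] => //; exact: basis_elts.
  move=> d; exists [seq strand_elt e | e <- deg_indices d]; first by rewrite size_map size_deg_indices.
  exact: basis_deg_elts.
exists lin_x; split; [|exact: lin_x_neq0|].
  by have := lin_x_piece 1; rewrite expr1.
exists [seq (strand_gen x, (fam_len (strand_at x.1), x.2)) | x <- gen_indices]; split.
- move=> v p nu /mapP[[r nu'] rI [-> -> ->]].
  have h : in_fam fs r nu' by rewrite -mem_gen_indices.
  have [p0 _ _ _ _] := ds_wf _ _ _ DS _ _ h.
  by split=> //; [exact: strand_gen_piece|exact: strand_gen_string].
- by rewrite string_elts; exact: basis_elts.
- by rewrite fam_typesE -map_comp.
Qed.
End Criterion.

Local Close Scope quotient_scope.
Local Close Scope ring_scope.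
Local Open Scope nat_scope.

(** * Forms and strings for the twenty-six types *)

Definition yz_monomial (b c : nat) : dpoly := [:: (1%R, (b, c))].
Definition one_gen (nu : nat) := yz_monomial 0 0.
Definition y_power (nu : nat) := yz_monomial nu 0.
Definition z_power (nu : nat) := yz_monomial 0 nu.
Definition y_z_power (nu : nat) := yz_monomial 1 (nu - 1).
Definition yy_z_power (nu : nat) := yz_monomial 2 (nu - 2).

(** The exponents of y and z in the monomials of a form of degree [j] that
    realises the [n]-th type with l = x. *)
Definition form_support (j n : nat) : seq (nat * nat) :=
  match n with
  | 1 => [:: (0, 0); (1, 1)]
  | 2 => [:: (0, 0); (2, 0); (0, 1); (0, j)]
  | 3 => [:: (0, 0); (0, 1); (3, 0)]
  | 4 => [:: (0, 0); (2, 0); (0, j)]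
  | 5 => [:: (0, 0); (1, 0); (0, j - 1)]
  | 6 => [:: (0, 0); (1, 0); (j - 1, 0); (j - 1, 1)]
  | 7 => [:: (0, 0); (1, 0); (1, j - 1)]
  | 8 => [:: (0, 0); (1, 0); (2, 0); (0, j)]
  | 9 => [:: (0, 0); (0, j - 2); (1, j - 2); (2, j - 2)]
  | 10 => [:: (0, 0); (0, j - 2); (1, j - 1)]
  | 11 => [:: (0, 0); (2, j - 2); (0, j - 1)]
  | 12 => [:: (0, 0); (2, j - 2)]
  | 13 => [:: (0, 1); (2, 0); (3, 0)]
  | 14 => [:: (0, 1); (2, 0); (0, j)]
  | 15 => [:: (0, 1); (3, 0)]
  | 16 => [:: (1, 0); (2, 0); (0, j)]
  | 17 => [:: (1, 0); (0, j - 1)]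
  | 18 => [:: (1, 0); (j - 1, 0); (j - 1, 1)]
  | 19 => [:: (1, 0); (1, j - 1)]
  | 20 => [:: (1, 1)]
  | 21 => [:: (2, 0); (0, j)]
  | 22 => [:: (0, j - 3); (1, j - 2)]
  | 23 => [:: (0, j - 3); (1, j - 1)]
  | 24 => [:: (0, j - 2); (2, j - 2)]
  | 25 => [:: (1, j - 2)]
  | 26 => [:: (0, j - 1); (3, j - 3)]
  | _ => [::]
  end.

(** Strings of the [n]-th type for the form above.  In a generator, the
    terms after the first make it orthogonal to all the strings but its dual. *)
Definition strands (j n : nat) : seq strand :=
  match n with
  | 1 => [:: Strand (j + 1) 0 0 one_gen 0;
      Strand (j - 1) 1 1 y_power 2;
      Strand (j - 1) 1 1 z_power 1;
      Strand (j - 3) 2 2 (fun nu => [:: (1%R, (1, 1)); ((-1)%R, (0, 0))]) 3]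
  | 2 => [:: Strand (j + 1) 0 0 one_gen 0;
      Strand (j - 1) 1 1 y_power 1;
      Strand (j - 1) 1 1 (fun nu => [:: (1%R, (0, 1)); ((-1)%R, (0, 0))]) 2;
      Strand 1 2 (j - 2) z_power 3]
  | 3 => [:: Strand (j + 1) 0 0 one_gen 0;
      Strand (j - 1) 1 1 (fun nu => [:: (1%R, (0, 1)); ((-1)%R, (0, 0))]) 1;
      Strand (j - 2) 1 1 y_power 3;
      Strand (j - 2) 2 2 y_power 2]
  | 4 => [:: Strand (j + 1) 0 0 one_gen 0;
      Strand (j - 1) 1 1 y_power 1;
      Strand (j - 3) 2 2 (fun nu => [:: (1%R, (2, 0)); ((-1)%R, (0, 0))]) 2;
      Strand 1 1 (j - 1) z_power 3]
  | 5 => [:: Strand (j + 1) 0 0 one_gen 0;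
      Strand (j - 1) 1 1 (fun nu => [:: (1%R, (1, 0)); ((-1)%R, (0, 0))]) 1;
      Strand 2 1 (j - 2) z_power 2]
  | 6 => [:: Strand (j + 1) 0 0 one_gen 0;
      Strand (j - 1) 1 1 (fun nu => [:: (1%R, (1, 0)); ((-1)%R, (0, 0))]) 1;
      Strand 2 2 (j - 3) y_power 2;
      Strand 1 1 1 z_power 4;
      Strand 1 (j - 1) (j - 1) (fun nu => [:: (1%R, (nu, 0)); ((-1)%R, (1, 0))]) 3;
      Strand 1 2 2 y_z_power 6;
      Strand 1 (j - 2) (j - 2) (fun nu => [:: (1%R, (nu, 0)); ((-1)%R, (0, 0)); (1%R, (1, 0))]) 5]
  | 7 => [:: Strand (j + 1) 0 0 one_gen 0;
      Strand (j - 1) 1 1 (fun nu => [:: (1%R, (1, 0)); ((-1)%R, (0, 0))]) 1;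
      Strand 1 1 (j - 2) z_power 3;
      Strand 1 2 (j - 1) y_z_power 2]
  | 8 => [:: Strand (j + 1) 0 0 one_gen 0;
      Strand (j - 2) 1 1 (fun nu => [:: (1%R, (1, 0)); ((-1)%R, (0, 0))]) 2;
      Strand (j - 2) 2 2 (fun nu => [:: (2%R, (2, 0)); ((-1)%R, (1, 0)); ((-1)%R, (0, 0))]) 1;
      Strand 1 1 (j - 1) z_power 3]
  | 9 => [:: Strand (j + 1) 0 0 one_gen 0;
      Strand 3 1 (j - 3) z_power 1;
      Strand 2 1 1 y_power 3;
      Strand 2 (j - 2) (j - 2) (fun nu => [:: (1%R, (0, nu)); ((-1)%R, (0, 0))]) 2]
  | 10 => [:: Strand (j + 1) 0 0 one_gen 0;
      Strand 3 1 (j - 3) z_power 1;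
      Strand 1 1 1 y_power 3;
      Strand 1 (j - 1) (j - 1) z_power 2;
      Strand 1 2 2 y_z_power 5;
      Strand 1 (j - 2) (j - 2) (fun nu => [:: (1%R, (0, nu)); ((-1)%R, (0, 0))]) 4]
  | 11 => [:: Strand (j + 1) 0 0 one_gen 0;
      Strand 2 1 (j - 2) z_power 1;
      Strand 1 1 (j - 1) y_z_power 2]
  | 12 => [:: Strand (j + 1) 0 0 one_gen 0;
      Strand 1 1 (j - 1) y_z_power 1;
      Strand 1 1 (j - 2) z_power 3;
      Strand 1 2 (j - 1) yy_z_power 2]
  | 13 => [:: Strand j 0 0 one_gen 1;
      Strand j 1 1 z_power 0;
      Strand (j - 1) 1 1 y_power 2;
      Strand (j - 3) 2 2 (fun nu => [:: (1%R, (2, 0)); ((-1)%R, (1, 0)); ((-1)%R, (0, 1))]) 3]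
  | 14 => [:: Strand j 0 0 one_gen 1;
      Strand j 1 1 z_power 0;
      Strand (j - 1) 1 1 y_power 2;
      Strand 1 2 (j - 2) z_power 3]
  | 15 => [:: Strand j 0 0 one_gen 1;
      Strand j 1 1 z_power 0;
      Strand (j - 2) 1 1 y_power 3;
      Strand (j - 2) 2 2 y_power 2]
  | 16 => [:: Strand j 0 0 one_gen 1;
      Strand j 1 1 (fun nu => [:: (2%R, (1, 0)); ((-1)%R, (0, 0))]) 0;
      Strand (j - 3) 2 2 (fun nu => [:: (1%R, (2, 0)); ((-1)%R, (1, 0)); (1%R, (0, 0))]) 2;
      Strand 1 1 (j - 1) z_power 3]
  | 17 => [:: Strand j 0 0 one_gen 1;
      Strand j 1 1 y_power 0;
      Strand 2 1 (j - 2) z_power 2]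
  | 18 => [:: Strand j 0 0 one_gen 1;
      Strand j 1 1 y_power 0;
      Strand 2 2 (j - 3) y_power 2;
      Strand 1 1 1 z_power 4;
      Strand 1 (j - 1) (j - 1) (fun nu => [:: (1%R, (nu, 0)); ((-1)%R, (1, 0))]) 3;
      Strand 1 2 2 y_z_power 6;
      Strand 1 (j - 2) (j - 2) (fun nu => [:: (1%R, (nu, 0)); ((-1)%R, (0, 0))]) 5]
  | 19 => [:: Strand j 0 0 one_gen 1;
      Strand j 1 1 y_power 0;
      Strand 1 1 (j - 2) z_power 3;
      Strand 1 2 (j - 1) y_z_power 2]
  | 20 => [:: Strand (j - 1) 0 0 one_gen 3;
      Strand (j - 1) 1 1 y_power 2;
      Strand (j - 1) 1 1 z_power 1;
      Strand (j - 1) 2 2 y_z_power 0]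
  | 21 => [:: Strand (j - 1) 0 0 one_gen 2;
      Strand (j - 1) 1 1 y_power 1;
      Strand (j - 1) 2 2 y_power 0;
      Strand 1 1 (j - 1) z_power 3]
  | 22 => [:: Strand 4 0 (j - 3) z_power 0;
      Strand 2 1 1 y_power 2;
      Strand 2 (j - 2) (j - 2) z_power 1]
  | 23 => [:: Strand 4 0 (j - 3) z_power 0;
      Strand 1 1 1 y_power 2;
      Strand 1 (j - 1) (j - 1) z_power 1;
      Strand 1 2 2 y_z_power 4;
      Strand 1 (j - 2) (j - 2) z_power 3]
  | 24 => [:: Strand 3 0 (j - 2) z_power 0;
      Strand 1 1 (j - 1) y_z_power 1]
  | 25 => [:: Strand 2 0 (j - 2) z_power 1;
      Strand 2 1 (j - 1) y_z_power 0]
  | 26 => [:: Strand 2 0 (j - 1) z_power 0;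
      Strand 1 1 (j - 2) y_z_power 2;
      Strand 1 2 (j - 1) yy_z_power 1]
  | _ => [::]
  end.

Definition admissible (j n : nat) : bool :=
  (0 < n < 27) && (4 < j) || (j == 4) && (n \in short_types).

Definition coeff_in (j n b c : nat) : bool :=
  has (fun m => (b == m.1) && (c == m.2)) (form_support j n).

(** Decides equalities between exponents from the ranges of the degrees, and
    splits on those that depend on a parameter. *)
Ltac decide_eqs :=
  repeat match goal with
  | |- context [@eq_op _ (?a : nat) ?b] =>
     first [ have -> : (a == b) = false by lia
           | have -> : (a == b) = true by lia
           | case: (eqVneq a b) => [?|?] ]
  end.

Lemma wf_strands j n : admissible j n ->
  forall r nu, in_fam (strands j n) r nu ->
    let f := nth no_strand (strands j n) r in
    [/\ (0 < fam_len f)%N, all (fun t => t.2.1 + t.2.2 <= nu)%N (fam_gen f nu),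
        in_fam (strands j n) (fam_dual f) (j + 1 - fam_len f - nu), (nu + fam_len f <= j + 1)%N &
        fam_dual (nth no_strand (strands j n) (fam_dual f)) = r /\
        fam_len (nth no_strand (strands j n) (fam_dual f)) = fam_len f].
Proof.
rewrite /admissible /short_types !inE => adm r nu.
do 27?[case: n adm => [|n] adm]; try (by exfalso; lia); rewrite /strands /in_fam /=.
all: do 7?[case: r => [|r]] => //=.
all: move=> hnu; split=> //; try lia.
Qed.

Ltac decide_coeffs :=
  repeat match goal with
  | |- context [coeff_in ?j ?n ?b ?c] =>
     first [ have -> : coeff_in j n b c = false
               by rewrite /coeff_in /=; lia
           | have -> : coeff_in j n b c = true
               by rewrite /coeff_in /=; lia
           | rewrite /coeff_in /=; decide_eqs ]
  end.

Ltac gram_tac :=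
  let r := fresh "r" in let nu := fresh "nu" in
  let r' := fresh "r'" in let nu' := fresh "nu'" in
  move=> r nu r' nu'; rewrite /in_fam /= ?subSS ?subn0;
  do 7?[case: r => [|r]] => //=; do 7?[case: r' => [|r']] => //=; rewrite ?subSS ?subn0;
  move=> hnu hnu' hj;
  rewrite /gram !(big_cons, big_nil); cbn [fst snd]; decide_coeffs; rewrite /=;
  decide_eqs; first [done | exfalso; lia].

Lemma gram_strands j n : admissible j n -> forall r nu r' nu',
  in_fam (strands j n) r nu -> in_fam (strands j n) r' nu' -> nu + nu' <= j ->
    let f := nth no_strand (strands j n) r in
    let f' := nth no_strand (strands j n) r' in
    (gram (coeff_in j n) (fam_gen f nu) (fam_gen f' nu') != 0%R) =
    (r' == fam_dual f) && (nu + nu' + fam_len f == j + 1).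
Proof.
rewrite /admissible /short_types !inE => adm.
do 27?[case: n adm => [|n] adm]; try by (exfalso; lia).
all: first [have {adm} jn : 4 < j by clear -adm; lia | have {adm} jn : 3 < j by clear -adm; lia].
(* Writing j as a successor removes truncated subtractions from the degrees. *)
all: case: j jn => [|[|[|[|j]]]] // jn; abstract gram_tac.
Qed.

(** Monomials (as exponents of y and z) that span degree [d] of the quotient when
    2 <= d <= j - 2, and the relations that bring to them those other monomials
    that are not zero.  In small degrees a listed relation may start from a
    monomial of the spanning set, or from exponents of sum larger than d, and is
    then void. *)
Definition middle_monomials (n d : nat) : seq (nat * nat) :=
  match n with
  | 1 | 20 => [:: (0, 0); (1, 0); (0, 1); (1, 1)]
  | 2 | 14 | 4 | 8 | 16 | 21 => [:: (0, 0); (1, 0); (2, 0); (0, d)]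
  | 3 | 13 | 15 => [:: (0, 0); (1, 0); (2, 0); (0, 1)]
  | 5 | 17 => [:: (0, 0); (1, 0); (0, d); (0, d - 1)]
  | 6 | 18 => [:: (0, 0); (1, 0); (d, 0); (d - 1, 1)]
  | 7 | 19 => [:: (0, 0); (1, 0); (0, d); (1, d - 1)]
  | 9 => [:: (0, 0); (0, d); (0, d - 1); (1, d - 2)]
  | 10 => [:: (0, 0); (0, d); (0, d - 1); (1, d - 1)]
  | 11 => [:: (0, 0); (0, d); (0, d - 1); (1, d - 1)]
  | 12 => [:: (0, 0); (0, d); (1, d - 1); (2, d - 2)]
  | 22 => [:: (0, d); (0, d - 1); (0, d - 2); (1, d - 2)]
  | 23 => [:: (0, d); (0, d - 1); (0, d - 2); (1, d - 1)]
  | 24 => [:: (0, d); (0, d - 1); (0, d - 2); (1, d - 1)]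
  | 25 => [:: (0, d); (0, d - 1); (1, d - 1); (1, d - 2)]
  | _ => [:: (0, d); (1, d - 1); (2, d - 2); (0, d - 1)]
  end.

Definition middle_relations (n d : nat) : seq (nat * nat * (nat * nat)) :=
  match n with
  | 2 | 14 => [:: (0, 1, (2, 0))]
  | 3 | 13 | 15 => [:: (3, 0, (0, 1))]
  | 6 | 18 => [:: (d - 1, 0, (d - 1, 1))]
  | 9 => [:: (1, d - 1, (0, d - 1)); (2, d - 2, (1, d - 2)); (0, d - 2, (1, d - 2))]
  | 10 => [:: (0, d - 2, (1, d - 1))]
  | 11 => [:: (2, d - 2, (0, d - 1))]
  | 22 => [:: (1, d - 1, (0, d - 2)); (0, d - 3, (1, d - 2))]
  | 23 => [:: (0, d - 3, (1, d - 1))]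
  | 24 => [:: (2, d - 2, (0, d - 2))]
  | 26 => [:: (3, d - 3, (0, d - 1))]
  | _ => [::]
  end.

Lemma spanned_by (U : seq (nat * nat)) (rel : seq (nat * nat * (nat * nat))) j F m d :
  size U <= m -> all (fun u => u.1 + u.2 <= d) U -> all (fun r => r.2 \in U) rel ->
  (forall r, r \in rel -> r.1 \notin U -> r.1.1 + r.1.2 <= d ->
     forall x y, x + y + d <= j -> F (r.1.1 + x) (r.1.2 + y) = F (r.2.1 + x) (r.2.2 + y)) ->
  (forall b c, b + c <= d -> (b, c) \notin U -> (b, c) \notin unzip1 rel ->
     forall x y, x + y + d <= j -> F (b + x) (c + y) = false) ->
  spanned j F m d.
Proof.
move=> szU dU /allP relU relF F0; exists U; split=> // b c bc.
have [bcU|bcU] := boolP ((b, c) \in U); first by right; exists (b, c).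
have [/mapP[[r u] rR e]|bcR] := boolP ((b, c) \in unzip1 rel); last by left; exact: F0.
right; exists u; first exact: (relU _ rR).
by apply: (relF (b, c, u)) => //; rewrite [(b, c)]e.
Qed.

Ltac span_tac n d :=
  apply: (spanned_by (middle_monomials n d) (middle_relations n d));
  [ by []
  | rewrite /= ?subSS ?subn0; lia
  | rewrite /= ?inE ?xpair_eqE ?eqxx ?orbT; lia
  | move=> r; rewrite /= ?in_nil // ?inE; do ?[case/orP];
    move=> /eqP -> /=; rewrite ?inE ?xpair_eqE ?subSS ?subn0 /= => ? ? x y hxy;
    rewrite /coeff_in /= ?orbF ?subSS ?subn0; apply/idP/idP;
    do ?[case/orP]; case/andP => /eqP ? /eqP ?; lia
  | move=> b c bc; rewrite /= ?inE ?xpair_eqE ?negb_or ?subSS ?subn0 => /and4P[? ? ? ?] nR x y hxy;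
    rewrite /coeff_in /= ?orbF ?subSS ?subn0; apply/negP;
    do ?[case/orP]; case/andP => /eqP ? /eqP ?; lia ].

Lemma spanned_middle j n d : admissible j n -> 2 <= d -> d + 2 <= j ->
  spanned j (coeff_in j n) 4 d.
Proof.
move=> adm d2 dj; have j3 : 3 < j by lia.
move: adm; rewrite /admissible /short_types !inE => adm.
do 27?[case: n adm => [|n] adm]; try by (exfalso; lia).
(* With d and j written as successors no truncated subtraction remains. *)
all: clear adm; case: d d2 dj => [|[|d]] // d2 dj; case: j j3 dj => [|[|[|[|j]]]] // j3 dj.
all: match goal with |- spanned _ (coeff_in _ ?n) _ ?d => span_tac n d end.
Qed.

Lemma string_rank_up1 p nu i d : string_rank (up p nu nu) i d = (nu <= d) && (d + i < nu + p).
Proof. by rewrite /up /index_iota subSnn /= /string_rank /= addn0. Qed.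
Lemma string_rank_nil i d : string_rank [::] i d = 0. Proof. by []. Qed.
Lemma up01 p : up p 0 1 = at_ p [:: 0; 1]. Proof. by []. Qed.
Lemma up12 p : up p 1 2 = at_ p [:: 1; 2]. Proof. by []. Qed.
Lemma up02 p : up p 0 2 = at_ p [:: 0; 1; 2]. Proof. by []. Qed.

Lemma string_rank_up_first p a b i d : a <= b ->
  string_rank (up p a b) i d = string_rank (at_ p [:: a]) i d + string_rank (up p a.+1 b) i d.
Proof. by move=> ab; rewrite -string_rank_cat /up /index_iota subSn // subSS. Qed.
Lemma string_rank_up_last p a b c i d : a <= b.+1 -> b.+1 = c ->
  string_rank (up p a c) i d = string_rank (up p a b) i d + string_rank (at_ p [:: c]) i d.
Proof.
move=> ab <-; rewrite -string_rank_cat /up -map_cat /index_iota subSn // -addn1 iotaD /=.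
by rewrite subnKC.
Qed.

(** The two lists are compared through their ranks.  Ranges with different end
    points are first cut so that the same ranges appear on both sides. *)
Lemma perm_strands j n : admissible j n -> perm_eq (fam_types (strands j n)) (jdt_seq j n).
Proof.
move=> adm; apply: perm_of_string_ranks.
- apply/allP => x; rewrite /fam_types; case/flattenP => s.
  case/(nthP [::]) => r; rewrite size_map => rs <-; rewrite (nth_map no_strand) //.
  case/mapP => m; rewrite mem_index_iota ltnS => hm ->.
  have h : in_fam (strands j n) r m by rewrite /in_fam rs.
  by have [] := wf_strands j n adm r m h.
- apply: jdt_seq_pos; move: adm; rewrite /admissible; lia.
move=> i d.
have first p : 3 < j ->
    string_rank (up p 1 (j - 2)) i d =
    string_rank (at_ p [:: 1]) i d + string_rank (up p 2 (j - 2)) i d.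
  by move=> j3; rewrite string_rank_up_first //; lia.
have last a p : a < 3 -> 3 < j ->
    string_rank (up p a (j - 1)) i d =
    string_rank (up p a (j - 2)) i d + string_rank (at_ p [:: j - 1]) i d.
  by move=> a3 j3; apply: string_rank_up_last; lia.
move: adm; rewrite /admissible /short_types !inE => adm.
do 27?[case: n adm => [|n] adm]; try by (exfalso; lia).
all: (have j3 : 3 < j by clear -adm; lia); clear adm.
all: rewrite /fam_types /jdt_seq; cbn [strands map flatten foldr fam_len fam_lo fam_hi].
all: rewrite ?(string_rank_nil, string_rank_cat, string_rank_pow2) ?(last 0) ?(last 1) ?(last 2) ?first //.
all: rewrite ?(up01, up12, up02).
all: rewrite ?(string_rank_cat, string_rank_pow2, string_rank_up1, string_rank_at_nil, string_rank_at_cons).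
all: repeat match goal with |- context [nat_of_bool ?b] => move: (nat_of_bool b) => ? end.
all: repeat match goal with |- context [string_rank ?b ?x ?y] => move: (string_rank b x y) => ? end.
all: try lia.
Qed.

Lemma nth_T4 j d : 3 < j -> nth 0 (T4 (j - 3)) d =
  if d == 0 then 1 else if d == 1 then 3 else if d + 2 <= j then 4
  else if d == j - 1 then 3 else if d == j then 1 else 0.
Proof.
move=> j3; case: d => [|[|d]] //; rewrite /T4 /= nth_cat size_nseq nth_nseq.
have [dj|[dj|[dj|dj]]] : d.+4 <= j \/ d = j - 3 \/ d = j - 2 \/ j < d.+2 by [clear; lia].
- by rewrite (_ : d < j - 3 = true); [splitif|]; lia.
- by rewrite dj ltnn subnn /=; splitif; lia.
- have -> : d - (j - 3) = 1 by lia.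
  by splitif; lia.
- have -> : d - (j - 3) = (d - (j - 1)).+2 by lia.
  by rewrite /= nth_nil; splitif; lia.
Qed.

Lemma hilbert_jdt j n d : admissible j n -> string_rank (jdt_seq j n) 0 d = nth 0 (T4 (j - 3)) d.
Proof.
move=> adm; rewrite nth_T4; last by move: adm; rewrite /admissible; lia.
move: adm; rewrite /admissible /short_types !inE => adm.
do 27?[case: n adm => [|n] adm]; try by (exfalso; lia).
all: first [have {adm} jn : 4 < j by clear -adm; lia | have {adm} jn : 3 < j by clear -adm; lia].
all: case: j jn => [|[|[|[|j]]]] // jn.
all: cbv beta iota delta [jdt_seq]; rewrite ?string_rankE ?subSS ?subn0 ?addn0.
all: have [->|[->|[e|[e|[e|e]]]]] : d = 0 \/ d = 1 \/ (2 <= d /\ d + 2 <= j) \/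
  d = j - 1 \/ d = j \/ j < d by [clear; lia].
all: splitif; lia.
Qed.

(** A monomial of F divisible by x shows that x is nonzero in the quotient. *)
Lemma low_coefficient j n : admissible j n ->
  exists b c, coeff_in j n b c /\ b + c < j.
Proof.
rewrite /admissible /short_types !inE => adm.
pose m := head (0, 0) (form_support j n); exists m.1, m.2; rewrite /m /coeff_in.
do 27?[case: n adm @m => [|n] adm m]; try by (exfalso; lia).
all: have j3 : 3 < j by clear -adm; lia.
all: by split; rewrite /= ?eqxx //; clear -j3; lia.
Qed.

Lemma jdt_occurring (K : fieldType) (charK : [pchar K]%R =i pred0) (k j n : nat) :
  0 < k -> j = k + 3 -> admissible j n -> occurring K (T4 k) (jdt j n).
Proof.
move=> k0 hj adm; have [b [c [bcS bcj]]] := low_coefficient j n adm.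
have kj : k = j - 3 by lia.
have permS := perm_strands j n adm.
rewrite /jdt -(eq_seq_msetP _ _ permS).
apply: (dual_system_occurring K charK k j k0 hj (coeff_in j n) b c bcS bcj).
- split; [exact: wf_strands | exact: gram_strands].
- by move=> d; rewrite kj -(hilbert_jdt j n d adm); move/permP: permS; apply.
- by move=> d; apply: spanned_middle.
Qed.

(** * The occurring types *)

Lemma occurring_gor_ranks (K : fieldType) k S : 0 < k -> occurring K (T4 k) S ->
  exists t, [/\ S = seq_mset t, all (fun x => 0 < x.1) t & gor_ranks (k + 3) (string_rank t)].
Proof.
move=> k0 [I [homI _ gorI hilbI] [l [l1 l0 [s [sP sB ->]]]]].
exists [seq x.2 | x <- s]; split=> //.
  by apply/allP => _ /mapP[[v [p nu]] /sP[p0 _ _] ->].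
exact: (gor_ranks_of_strings K k _ I l s).
Qed.

Lemma admissible_table j n : admissible j n -> table_of j (string_rank (jdt_seq j n)) n.
Proof.
case/orP => /andP[a b] i d d2 idj; first exact: string_rank_jdt.
by move: idj; rewrite (eqP a) => idj; apply: string_rank_jdt4.
Qed.

Lemma classification j h : 3 < j -> gor_ranks j h -> exists2 n, admissible j n & table_of j h n.
Proof.
move=> j3 hG; rewrite /admissible.
have [j4|[j5|j5]] : j = 4 \/ j = 5 \/ 5 < j by lia.
- by have [n nS nt] := classify4 j h hG j4; exists n => //; rewrite nS j4 orbT.
- by have [n nS nt] := classify5 j h hG j5; exists n => //; rewrite nS j5.
- by have [n nS nt] := classify_big j h hG j5; exists n => //; rewrite nS ltnW.
Qed.

(** A type is determined by its table, and the table by its column profiles; the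
    type of the list with the same profiles occurs, so its ranks satisfy the same constraints and
    agree with those of the given type. *)
Theorem occurringP (K : fieldType) (charK : [pchar K]%R =i pred0) (k j : nat) S :
  0 < k -> j = k + 3 ->
  occurring K (T4 k) S <-> exists2 n, admissible j n & S = jdt j n.
Proof.
move=> k0 hj; split=> [|[n adm ->]]; last exact: jdt_occurring.
have j3 : 3 < j by lia.
case/(occurring_gor_ranks K k S k0) => t [-> t0]; rewrite -hj => tG.
have [n adm tn] := classification j (string_rank t) j3 tG; exists n => //.
have [u [/eq_seq_msetP/permP ju _ ]] := occurring_gor_ranks K k _ k0 (jdt_occurring K charK k j n k0 hj adm).
rewrite -hj => uG.
have un : table_of j (string_rank u) n.
  by move=> i d d2 idj; rewrite -(admissible_table j n adm) // /string_rank ju.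
apply/eq_seq_msetP/perm_of_string_ranks => // [|i d]; first exact: jdt_seq_pos.
by rewrite (table_unique j _ _ n j3 tG uG) // /string_rank ju.
Qed.

Lemma undup_size (T : eqType) (s t : seq T) : uniq t -> s =i t -> size (undup s) = size t.
Proof. by move=> ut st; rewrite (perm_size (uniq_perm (undup_uniq s) ut _)) // => x; rewrite mem_undup. Qed.

Theorem theorem4p7 (K : fieldType) (charK : [pchar K]%R =i pred0) (k j : nat)
    (hj : j = k + 3) :
  [/\ 3 <= k ->
        occurring_exactly K (T4 k) 26 [seq jdt j i | i <- index_iota 1 27],
      k = 2 ->
        [/\ jdt j 4 = jdt j 6, jdt j 8 = jdt j 10,
            jdt j 16 = jdt j 18, jdt j 21 = jdt j 23
          & occurring_exactly K (T4 k) 22 [seq jdt j i | i <- index_iota 1 27]]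
    & k = 1 ->
        jdt j 3 = jdt j 5 /\
        occurring_exactly K (T4 k) 12
          [seq jdt j i | i <- [:: 1; 3; 7; 8; 12; 13; 15; 19; 20; 24; 25; 26]]].
Proof.
have occ (L : seq nat) : 0 < k -> (forall n, (n \in L) = admissible j n) ->
    forall S, occurring K (T4 k) S <-> S \in [seq jdt j i | i <- L].
  move=> k0 LE S; split.
    by case/(occurringP K charK k j S k0 hj) => n adm ->; apply: map_f; rewrite LE.
  case/mapP => n; rewrite LE => adm ->; exact: jdt_occurring.
have big n : 4 < j -> (n \in index_iota 1 27) = admissible j n.
  by move=> j4; rewrite mem_index_iota /admissible j4 andbT; case: eqP => [e|_]; [lia|rewrite orbF].
split=> hk.
- have j5 : 5 < j by lia.
  split; first by rewrite undup_id ?size_map //; apply: jdt_uniq.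
  by refine (occ _ _ (fun n => big n _)); [exact: ltnW (ltnW hk)|exact: ltnW].
- have j5 : j = 5 by rewrite hj hk.
  have all26 S : occurring K (T4 k) S <-> S \in [seq jdt j i | i <- index_iota 1 27].
    by apply: (occ (index_iota 1 27)) => [|n]; [rewrite hk | apply: big; rewrite j5].
  rewrite j5 in all26 *; have [e4 e8 e16 e21] := jdt_coincide5.
  split=> //; split=> //; rewrite (undup_size _ _ _ jdt_uniq5) // => S.
  apply/mapP/mapP => [[n nL ->]|[n]]; last by rewrite mem_filter => /andP[_ nL] ->; exists n.
  exists (if n == 6 then 4 else if n == 10 then 8 else if n == 18 then 16
          else if n == 23 then 21 else n).
    by rewrite mem_filter; move: nL; rewrite !mem_index_iota !inE; splitif; lia.
  by do 4?[case: eqP => [->|_] //].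
- have j4 : j = 4 by rewrite hj hk.
  have all12 S : occurring K (T4 k) S <-> S \in [seq jdt j i | i <- short_types].
    by apply: (occ short_types) => [|n]; [rewrite hk | rewrite /admissible j4 andbF].
  rewrite j4 in all12 *; split; first exact: jdt_coincide4.
  by split=> //; rewrite undup_id // jdt_uniq4.
Qed.
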